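(* Let $\mathfrak g=\mathfrak{sp}(N)$, $N=2n$, $m\in2\mathbb N$, $m\le n$, $i'=N+1-i$, and let $$A=\pm\Bigl(\sum_{i=1}^m q^{-m}(1-q^{-N+2m})e_{ii}+\sum_{m<i<m'}q^{-m}e_{ii}+\sum_{\substack{i\le m\text{ or }i'\le m\\ i\ \mathrm{odd}}}z_i(e_{i,i'-1}-e_{i+1,i'})\Bigr),$$ with $z_iz_{i'-1}=q^{-N}$ for all odd $i$ occurring in the sum. Let $\Pi_{\mathfrak l}=\{\alpha_{2i+1}\}_{i=0}^{\frac m2-1}\cup\{\alpha_i\}_{i=m+1}^n$. Let $U_q(\mathfrak k)\subset U_q(\mathfrak g)$ be the subalgebra generated by $e_i,f_i,q^{\pm h_i}$ with $\alpha_i\in\Pi_{\mathfrak l}$, and by $X_{\alpha_i}=q^{h_{\tilde\alpha_i}-h_{\alpha_i}}e_i+c_{\alpha_i}F_{\tilde\alpha_i}$, $q^{\pm(h_{\tilde\alpha_i}-h_{\alpha_i})}$ for even $i\le m$, with the following data: • for $i=1,\dots,\frac m2-1$: $\tilde\alpha_{2i}=\alpha_{2i-1}+\alpha_{2i}+\alpha_{2i+1}$, $F_{\tilde\alpha_{2i}}=[[F_{2i},F_{2i+1}]_q,F_{2i-1}]_q$, $c_{\alpha_{2i}}=-\dfrac{q\,z_{2i+1}}{z_{2i-1}}$; • if $m\le n-1$: $\tilde\alpha_m=\alpha_{m-1}+\alpha_m+2\sum_{l=m+1}^{n-1}\alpha_l+\alpha_n$, $c_{\alpha_m}=\dfrac{(-1)^{n+1}}{z_{m-1}q^m}$,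 and $$F_{\tilde\alpha_m}=[[\dots[[\dots[[F_m,F_{m+1}]_q,F_{m+2}]_q,\dots,F_n]_{q^2},F_{n-1}]_q,\dots,F_{m+1}]_q,F_{m-1}]_q\quad(m<n-1),$$ $$F_{\tilde\alpha_m}=[[F_{n-1},F_n]_{q^2},F_{n-2}]_q\quad(m=n-1)$$ (all brackets for $m<n-1$ have index $q$ except the one with $F_n$, which has index $q^2$); • if $m=n$: $\tilde\alpha_n=2\alpha_{n-1}+\alpha_n$, $F_{\tilde\alpha_n}=[[F_n,F_{n-1}]_{q^2},F_{n-1}]$, $c_{\alpha_n}=-\dfrac{1}{(q^2+1)q^{2n-2}z_{n-1}^2}$. Then $U_q(\mathfrak k)$ stabilizes $A$: $\pi(x)A=A\pi(x)$ for all $x\in U_q(\mathfrak k)$, where $\pi$ is the natural representation of $U_q(\mathfrak g)$ on $\mathbb C^N$.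
   Context: $q\in\mathbb C$ is nonzero and not a root of unity. $U_q(\mathfrak{sp}(2n))$ has generators $e_i,f_i,q^{\pm h_i}$, $1\le i\le n$, for the simple roots $\alpha_i=\varepsilon_i-\varepsilon_{i+1}$ ($i<n$), $\alpha_n=2\varepsilon_n$, $(\varepsilon_i,\varepsilon_j)=\delta_{ij}$: $q^{h_i}e_jq^{-h_i}=q^{(\alpha_i,\alpha_j)}e_j$, $q^{h_i}f_jq^{-h_i}=q^{-(\alpha_i,\alpha_j)}f_j$, $[e_i,f_j]=\delta_{ij}\frac{q^{h_i}-q^{-h_i}}{q-q^{-1}}$ for $i<n$, $[e_n,f_j]=\delta_{nj}\frac{q^{h_n}-q^{-h_n}}{q^2-q^{-2}}$, the $q^{\pm h_i}$ commute, plus the quantum Serre relations. For $\beta=\sum k_i\alpha_i$, $q^{h_\beta}=\prod_i(q^{h_i})^{k_i}$. Notation: $F_i=q^{h_i}f_i$, $[x,y]_a=xy-a\,yx$, $[x,y]=[x,y]_1$. With matrix units $e_{jk}$ (two indices), the natural representation $\pi:U_q(\mathfrak g)\to\mathrm{End}(\mathbb C^N)$ is, for $i<n$: $e_i\mapsto e_{i,i+1}-e_{(i+1)',i'}$, $f_i\mapsto e_{i+1,i}-e_{i',(i+1)'}$, $q^{h_i}\mapsto\sum_jq^{\delta_{ji}-\delta_{ji'}-\delta_{j,i+1}+\delta_{j,(i+1)'}}e_{jj}$; and $e_n\mapsto e_{n,n+1}$, $f_n\mapsto e_{n+1,n}$, $q^{h_n}\mapsto\sum_jq^{2\delta_{jn}-2\delta_{jn'}}e_{jj}$.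 *)

(* Defs.v *)
From HB Require Import structures.
From mathcomp Require Import all_boot all_order all_algebra.
From mathcomp Require Import boolp reals complex zify.

Set Implicit Arguments.
Unset Strict Implicit.
Unset Printing Implicit Defensive.

Import GRing.Theory.
Local Open Scope ring_scope.

(* Unital associative K-algebras given by generators and relations: formal  *)
(* expressions modulo the smallest congruence containing [rel] and the      *)
(* axioms of associative K-algebras.                                        *)

Inductive expr (K G : Type) : Type :=
| Gen of G
| Cst of K
| Add of expr K G & expr K G
| Mul of expr K G & expr K G.

Arguments Gen {K G}.
Arguments Cst {K G}.

Declare Scope expr_scope.
Delimit Scope expr_scope with X.
Bind Scope expr_scope with expr.
Notation "s + t" := (Add s t) : expr_scope.
Notation "s * t" := (Mul s t) : expr_scope.
Notation "c *: t" := (Mul (Cst c%R) t) : expr_scope.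
Notation "s - t" := (Add s (Mul (Cst (- 1)%R) t)) : expr_scope.
Notation "s ^+ k" := (iter k (Mul s) (Cst 1%R)) : expr_scope.

HB.instance Definition _ (K G : Type) := gen_eqMixin (expr K G).
HB.instance Definition _ (K G : Type) := gen_choiceMixin (expr K G).

Section Presented.
Variables (K : fieldType) (G : Type) (rel : expr K G -> expr K G -> Prop).

Inductive congr_rel : expr K G -> expr K G -> Prop :=
| cr_rel s t : rel s t -> congr_rel s t
| cr_refl s : congr_rel s s
| cr_sym s t : congr_rel s t -> congr_rel t s
| cr_trans s t u : congr_rel s t -> congr_rel t u -> congr_rel s u
| cr_add s s' t t' :
    congr_rel s s' -> congr_rel t t' -> congr_rel (s + t)%X (s' + t')%X
| cr_mul s s' t t' :
    congr_rel s s' -> congr_rel t t' -> congr_rel (s * t)%X (s' * t')%X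
| cr_addA s t u : congr_rel (s + (t + u))%X (s + t + u)%X
| cr_addC s t : congr_rel (s + t)%X (t + s)%X
| cr_add0 s : congr_rel (Cst 0 + s)%X s
| cr_addN s : congr_rel (s - s)%X (Cst 0)
| cr_mulA s t u : congr_rel (s * (t * u))%X (s * t * u)%X
| cr_mul1l s : congr_rel (Cst 1 * s)%X s
| cr_mul1r s : congr_rel (s * Cst 1)%X s
| cr_mulDl s t u : congr_rel ((s + t) * u)%X (s * u + t * u)%X
| cr_mulDr s t u : congr_rel (s * (t + u))%X (s * t + s * u)%X
| cr_cstD a b : congr_rel (Cst (a + b)%R) (Cst a + Cst b)%X
| cr_cstM a b : congr_rel (Cst (a * b)%R) (Cst a * Cst b)%X
| cr_cstC a s : congr_rel (Cst a * s)%X (s * Cst a)%X.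

Definition congr_relb s t := `[< congr_rel s t >].

Lemma congr_relb_refl : reflexive congr_relb.
Proof. by move=> s; apply/asboolP/cr_refl. Qed.

Lemma congr_relb_sym : symmetric congr_relb.
Proof. by move=> s t; apply/asboolP/asboolP; apply: cr_sym. Qed.

Lemma congr_relb_trans : transitive congr_relb.
Proof. by move=> t s u /asboolP st /asboolP tu; apply/asboolP/(cr_trans st). Qed.

Canonical congr_equiv :=
  EquivRel congr_relb congr_relb_refl congr_relb_sym congr_relb_trans.

Definition presented := {eq_quot congr_equiv}%qT.
HB.instance Definition _ := EqQuotient.on presented.
HB.instance Definition _ := Choice.on presented.

Definition cls (s : expr K G) : presented := (\pi_presented s)%qT.

Lemma clsP s t : cls s = cls t <-> congr_rel s t.
Proof.
by split=> [/eqquotP/asboolP //|st]; apply/eqquotP/asboolP.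
Qed.

Lemma cls_repr x : cls (repr x) = x.
Proof. exact: reprK. Qed.

Lemma repr_cls s : congr_rel (repr (cls s)) s.
Proof. by apply/clsP; rewrite cls_repr. Qed.

Lemma presentedW (P : presented -> Prop) : (forall s, P (cls s)) -> forall x, P x.
Proof. by move=> H x; rewrite -(cls_repr x). Qed.

Definition padd (x y : presented) := cls (repr x + repr y)%X.
Definition pmul (x y : presented) := cls (repr x * repr y)%X.
Definition popp (x : presented) := cls ((- 1)%R *: repr x)%X.
Definition pscale (c : K) (x : presented) := cls (c *: repr x)%X.

Lemma cls_add s t : cls (s + t)%X = padd (cls s) (cls t).
Proof. by apply/clsP; apply: cr_add; apply/cr_sym/repr_cls. Qed.

Lemma cls_mul s t : cls (s * t)%X = pmul (cls s) (cls t).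
Proof. by apply/clsP; apply: cr_mul; apply/cr_sym/repr_cls. Qed.

Lemma cls_opp s : cls ((- 1)%R *: s)%X = popp (cls s).
Proof. by apply/clsP/cr_mul; [apply: cr_refl|apply/cr_sym/repr_cls]. Qed.

Lemma cls_scale c s : cls (c *: s)%X = pscale c (cls s).
Proof. by apply/clsP/cr_mul; [apply: cr_refl|apply/cr_sym/repr_cls]. Qed.


Let paddA : associative padd.
Proof.
elim/presentedW=> s; elim/presentedW=> t; elim/presentedW=> u.
by rewrite -!cls_add; apply/clsP/cr_addA.
Qed.

Let paddC : commutative padd.
Proof.
elim/presentedW=> s; elim/presentedW=> t.
by rewrite -!cls_add; apply/clsP/cr_addC.
Qed.

Let padd0 : left_id (cls (Cst 0)) padd.
Proof. by elim/presentedW=> s; rewrite -!cls_add; apply/clsP/cr_add0. Qed.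

Let paddN : left_inverse (cls (Cst 0)) popp padd.
Proof.
elim/presentedW=> s; rewrite -cls_opp -cls_add; apply/clsP.
exact: cr_trans (cr_addC _ _) (cr_addN _).
Qed.

HB.instance Definition _ :=
  GRing.isZmodule.Build presented paddA paddC padd0 paddN.

Lemma clsD s t : cls (s + t)%X = cls s + cls t.
Proof. exact: cls_add. Qed.

Let pmulA : associative pmul.
Proof.
elim/presentedW=> s; elim/presentedW=> t; elim/presentedW=> u.
by rewrite -!cls_mul; apply/clsP/cr_mulA.
Qed.

Let pmul1l : left_id (cls (Cst 1)) pmul.
Proof. by elim/presentedW=> s; rewrite -!cls_mul; apply/clsP/cr_mul1l. Qed.

Let pmul1r : right_id (cls (Cst 1)) pmul.
Proof. by elim/presentedW=> s; rewrite -!cls_mul; apply/clsP/cr_mul1r. Qed.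

Let pmulDl : left_distributive pmul padd.
Proof.
elim/presentedW=> s; elim/presentedW=> t; elim/presentedW=> u.
by rewrite -!(cls_mul, cls_add); apply/clsP/cr_mulDl.
Qed.

Let pmulDr : right_distributive pmul padd.
Proof.
elim/presentedW=> s; elim/presentedW=> t; elim/presentedW=> u.
by rewrite -!(cls_mul, cls_add); apply/clsP/cr_mulDr.
Qed.

HB.instance Definition _ :=
  GRing.Zmodule_isPzRing.Build presented pmulA pmul1l pmul1r pmulDl pmulDr.

Lemma clsM s t : cls (s * t)%X = cls s * cls t.
Proof. exact: cls_mul. Qed.

Lemma cls_cst1 : cls (Cst 1) = 1.
Proof. by []. Qed.

Lemma cls_cst0 : cls (Cst 0) = 0.
Proof. by []. Qed.

Let pscaleA a b x : pscale a (pscale b x) = pscale (a * b) x.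
Proof.
elim/presentedW: x => s; rewrite -!cls_scale; apply/clsP.
apply: cr_trans (cr_mulA _ _ _) _.
by apply: cr_mul (cr_refl _); apply/cr_sym/cr_cstM.
Qed.

Let pscale1 : left_id 1 pscale.
Proof. by elim/presentedW=> s; rewrite -cls_scale; apply/clsP/cr_mul1l. Qed.

Let pscaleDr : right_distributive pscale +%R.
Proof.
move=> c; elim/presentedW=> s; elim/presentedW=> t.
by rewrite -clsD -!cls_scale -clsD; apply/clsP/cr_mulDr.
Qed.

Let pscaleDl x : {morph pscale^~ x : a b / a + b}.
Proof.
elim/presentedW: x => s a b; rewrite -!cls_scale -clsD; apply/clsP.
apply: cr_trans (cr_mulDl _ _ _).
by apply: cr_mul (cr_refl _); apply: cr_cstD.
Qed.

HB.instance Definition _ := GRing.Zmodule_isLmodule.Build K presented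
  pscaleA pscale1 pscaleDr pscaleDl.

Lemma clsZ c s : cls (c *: s)%X = c *: cls s.
Proof. exact: cls_scale. Qed.

Lemma presented_scalerAl (c : K) (x y : presented) : c *: (x * y) = (c *: x) * y.
Proof.
elim/presentedW: x => s; elim/presentedW: y => t.
by rewrite -[LHS]/(pscale _ (pmul _ _)) -[RHS]/(pmul (pscale _ _) _)
  -!(cls_mul, cls_scale); apply/clsP/cr_mulA.
Qed.

Lemma presented_scalerAr (c : K) (x y : presented) : c *: (x * y) = x * (c *: y).
Proof.
elim/presentedW: x => s; elim/presentedW: y => t.
rewrite -[LHS]/(pscale _ (pmul _ _)) -[RHS]/(pmul _ (pscale _ _)).
rewrite -!(cls_mul, cls_scale); apply/clsP.
apply: cr_trans (cr_mulA _ _ _) _; apply: cr_trans (cr_sym (cr_mulA _ _ _)).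
by apply: cr_mul (cr_refl _); apply: cr_cstC.
Qed.

(* [iota] makes [A] a K-algebra as soon as its image is central. *)
Section Lift.
Variables (A : pzRingType) (iota : {rmorphism K -> A}) (g : G -> A).

Fixpoint eval (s : expr K G) : A :=
  match s with
  | Gen x => g x
  | Cst c => iota c
  | Add t u => eval t + eval u
  | Mul t u => eval t * eval u
  end.

Definition lift (x : presented) : A := eval (repr x).

Hypothesis iotaC : forall c a, iota c * a = a * iota c.
Hypothesis eval_rel : forall s t, rel s t -> eval s = eval t.

Lemma eval_congr s t : congr_rel s t -> eval s = eval t.
Proof.
elim=> //= {s t}.
- by move=> s t u _ -> _ ->.
- by move=> s s' t t' _ -> _ ->.
- by move=> s s' t t' _ -> _ ->.
- by move=> *; rewrite addrA.
- by move=> *; rewrite addrC.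
- by move=> *; rewrite rmorph0 add0r.
- by move=> *; rewrite rmorphN rmorph1 mulN1r subrr rmorph0.
- by move=> *; rewrite mulrA.
- by move=> *; rewrite rmorph1 mul1r.
- by move=> *; rewrite rmorph1 mulr1.
- by move=> *; rewrite mulrDl.
- by move=> *; rewrite mulrDr.
- by move=> *; rewrite rmorphD.
- by move=> *; rewrite rmorphM.
Qed.

Lemma lift_cls s : lift (cls s) = eval s.
Proof. exact/eval_congr/repr_cls. Qed.

Lemma liftD x y : lift (x + y) = lift x + lift y.
Proof. exact: (lift_cls (repr x + repr y)%X). Qed.

Lemma liftM x y : lift (x * y) = lift x * lift y.
Proof. exact: (lift_cls (repr x * repr y)%X). Qed.

Lemma lift1 : lift 1 = 1.
Proof. by rewrite -(rmorph1 iota); apply: (lift_cls (Cst 1)). Qed.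

Lemma liftZ c x : lift (c *: x) = iota c * lift x.
Proof. exact: (lift_cls (c *: repr x)%X). Qed.

Lemma eval_sum I (r : seq I) (P : pred I) (f : I -> expr K G) :
  eval (\big[@Add K G/Cst 0]_(i <- r | P i) f i) = \sum_(i <- r | P i) eval (f i).
Proof. by elim/big_rec2: _ => [|i _ t _ <-] /=; rewrite ?rmorph0. Qed.

Lemma eval_exp s k : eval (s ^+ k)%X = eval s ^+ k.
Proof. by elim: k => [|k IH] /=; rewrite ?rmorph1 // IH exprS. Qed.

End Lift.
End Presented.

(* Coordinate of alpha_i on epsilon_k; indices range over 1, ..., n. *)
Definition simple_root (n i k : nat) : int :=
  if i == n then (2 * (k == n))%N%:Z else (k == i)%:Z - (k == i.+1)%:Z.

Definition root_dot (n i j : nat) : int :=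
  \sum_(1 <= k < n.+1) simple_root n i k * simple_root n j k.

Definition cartan (n i j : nat) : int :=
  ((2 * root_dot n i j) %/ root_dot n i i)%Z.

Definition node (n : nat) := {i : nat | (0 < i <= n)%N}.

Inductive Uq_gen (n : nat) : Type :=
| GenE of node n
| GenF of node n
| GenK of node n    (* q^{h_i} *)
| GenKV of node n.  (* q^{-h_i} *)

Section Uq.
Variables (K : fieldType) (q : K) (n : nat).

(* q^{(alpha_i, alpha_i) / 2} *)
Definition q_ (i : nat) : K := if i == n then q ^+ 2 else q.

Definition qint (p : K) (k : nat) : K := (p ^+ k - p ^- k) / (p - p^-1).
Definition qfact (p : K) (k : nat) : K := \prod_(1 <= l < k.+1) qint p l.
Definition qbinom (p : K) (k r : nat) : K :=
  qfact p k / (qfact p r * qfact p (k - r)).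

Local Notation E i := (@Gen K _ (GenE i)).
Local Notation F i := (@Gen K _ (GenF i)).
Local Notation Q i := (@Gen K _ (GenK i)).
Local Notation QV i := (@Gen K _ (GenKV i)).

Definition serre (i j : nat) (x y : expr K (Uq_gen n)) : expr K (Uq_gen n) :=
  let s := absz (1 - cartan n i j) in
  \big[@Add K (Uq_gen n)/Cst 0]_(r < s.+1)
    (((-1) ^+ r * qbinom (q_ i) s r)%R *: (x ^+ (s - r) * y * x ^+ r))%X.

Inductive Uq_rel : expr K (Uq_gen n) -> expr K (Uq_gen n) -> Prop :=
| rel_QQV i : Uq_rel (Q i * QV i)%X (Cst 1)
| rel_QVQ i : Uq_rel (QV i * Q i)%X (Cst 1)
| rel_QQ i j : Uq_rel (Q i * Q j)%X (Q j * Q i)%X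
| rel_QE i j :
    Uq_rel (Q i * E j * QV i)%X ((q ^ root_dot n (val i) (val j))%R *: E j)%X
| rel_QF i j :
    Uq_rel (Q i * F j * QV i)%X ((q ^ (- root_dot n (val i) (val j)))%R *: F j)%X
| rel_EF i :
    Uq_rel (E i * F i - F i * E i)%X
           ((q_ (val i) - (q_ (val i))^-1)^-1%R *: (Q i - QV i))%X
| rel_EF_neq i j : val i != val j -> Uq_rel (E i * F j - F j * E i)%X (Cst 0)
| rel_serreE i j : val i != val j ->
    Uq_rel (serre (val i) (val j) (E i) (E j)) (Cst 0)
| rel_serreF i j : val i != val j ->
    Uq_rel (serre (val i) (val j) (F i) (F j)) (Cst 0).

Definition Uq := presented Uq_rel.
HB.instance Definition _ := GRing.PzRing.on Uq.
HB.instance Definition _ := GRing.Lmodule.on Uq.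

Lemma Uq_nonzero1 : (1 : Uq) != 0.
Proof.
pose g (x : Uq_gen n) : K :=
  match x with GenE _ | GenF _ => 0 | GenK _ | GenKV _ => 1 end.
have serre0 i j x y : eval idfun g y = 0 -> eval idfun g (serre i j x y) = 0.
  by move=> y0; rewrite eval_sum big1 //= => r _; rewrite y0 mulr0 mul0r mulr0.
have relP s t : Uq_rel s t -> eval idfun g s = eval idfun g t.
  by case=> {s t} /= *; rewrite ?serre0 //
            ?(mulr0, mul0r, mul1r, mulr1, addr0, subrr, mulN1r).
have gC (c a : K) : idfun c * a = a * idfun c by rewrite mulrC.
apply/eqP=> U1; have := oner_neq0 K.
rewrite -(lift1 gC relP) U1 -(scale0r (0 : Uq)) (liftZ gC relP).
by rewrite mul0r eqxx.
Qed.

HB.instance Definition _ := GRing.PzSemiRing_isNonZero.Build Uq Uq_nonzero1.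
HB.instance Definition _ :=
  GRing.Lmodule_isLalgebra.Build K Uq (@presented_scalerAl _ _ _).
HB.instance Definition _ :=
  GRing.Lalgebra_isAlgebra.Build K Uq (@presented_scalerAr _ _ _).

(* Generators under their number 1 <= i <= n, and 0 outside this range. *)
Definition Ugen (c : node n -> Uq_gen n) (i : nat) : Uq :=
  if insub i is Some j then cls Uq_rel (Gen (c j)) else 0.

Definition e_ := Ugen (@GenE n).
Definition f_ := Ugen (@GenF n).
Definition qh_ := Ugen (@GenK n).
Definition qhV_ := Ugen (@GenKV n).

(* q^{h_beta} for beta = \sum_i (b i) alpha_i *)
Definition qh_root (b : nat -> int) : Uq :=
  \prod_(1 <= i < n.+1)
    match b i with Posz k => qh_ i ^+ k | Negz k => qhV_ i ^+ k.+1 end.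

Local Notation N := (2 * n)%N.

(* i' *)
Definition bar (i : nat) : nat := (N.+1 - i)%N.

(* Matrix unit with row and column numbers in 1, ..., N. *)
Definition munit (a b : nat) : 'M[K]_N :=
  \matrix_(j, k) ((j.+1 == a) && (k.+1 == b))%:R.

Definition nat_e (i : nat) : 'M[K]_N :=
  if i == n then munit n n.+1 else munit i i.+1 - munit (bar i.+1) (bar i).

Definition nat_f (i : nat) : 'M[K]_N :=
  if i == n then munit n.+1 n else munit i.+1 i - munit (bar i) (bar i.+1).

Definition nat_wt (i j : nat) : int :=
  if i == n then (2 * (j == n))%N%:Z - (2 * (j == bar n))%N%:Z
  else (j == i)%:Z - (j == bar i)%:Z - (j == i.+1)%:Z + (j == (bar i.+1))%:Z.

Definition nat_qh (i : nat) : 'M[K]_N :=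
  \sum_(1 <= j < N.+1) q ^ nat_wt i j *: munit j j.

Definition is_natural_rep (pi : {lrmorphism Uq -> 'M[K]_N}) : Prop :=
  forall i, (0 < i <= n)%N ->
    [/\ pi (e_ i) = nat_e i, pi (f_ i) = nat_f i & pi (qh_ i) = nat_qh i].

(* F_i *)
Definition Fq (i : nat) : Uq := qh_ i * f_ i.
Definition qbracket (a : K) (x y : Uq) : Uq := x * y - a *: (y * x).

Variables (m : nat) (z : nat -> K).

Definition in_Pi_l (i : nat) : bool := odd i && (i < m)%N || (m < i <= n)%N.

(* Coefficients of \tilde\alpha_i on the simple roots, for even i <= m. *)
Definition tilde_root (i l : nat) : int :=
  if (i < m)%N then ((l == i.-1) + (l == i) + (l == i.+1))%N%:Z
  else if (m < n)%N then
    ((l == m.-1) + (l == m) + 2 * (m < l < n) + (l == n))%N%:Z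
  else (2 * (l == n.-1) + (l == n))%N%:Z.

(* For i = m < n, [run] is F_(m+1), ..., F_(n-1); it is empty for m = n - 1,  *)
(* where the formula becomes [[F_(n-1), F_n]_(q^2), F_(n-2)]_q.               *)
Definition Fq_tilde (i : nat) : Uq :=
  if (i < m)%N then qbracket q (qbracket q (Fq i) (Fq i.+1)) (Fq i.-1)
  else if (m < n)%N then
    let run := [seq Fq l | l <- index_iota m.+1 n] in
    let up := foldl (qbracket q) (Fq m) run in
    let down := foldl (qbracket q) (qbracket (q ^+ 2) up (Fq n)) (rev run) in
    qbracket q down (Fq m.-1)
  else qbracket 1 (qbracket (q ^+ 2) (Fq n) (Fq n.-1)) (Fq n.-1).

Definition c_coef (i : nat) : K :=
  if (i < m)%N then - (q * z i.+1 / z i.-1)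
  else if (m < n)%N then (-1) ^+ n.+1 / (z m.-1 * q ^+ m)
  else - (1 / ((q ^+ 2 + 1) * q ^+ (2 * n - 2) * z n.-1 ^+ 2)).

(* \tilde\alpha_i - \alpha_i *)
Definition diff_root (i l : nat) : int := tilde_root i l - (l == i)%:Z.

Definition X_ (i : nat) : Uq :=
  qh_root (diff_root i) * e_ i + c_coef i *: Fq_tilde i.

Inductive Uk_gen : Uq -> Prop :=
| Uk_e i : in_Pi_l i -> Uk_gen (e_ i)
| Uk_f i : in_Pi_l i -> Uk_gen (f_ i)
| Uk_qh i : in_Pi_l i -> Uk_gen (qh_ i)
| Uk_qhV i : in_Pi_l i -> Uk_gen (qhV_ i)
| Uk_X i : ~~ odd i -> (0 < i <= m)%N -> Uk_gen (X_ i)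
| Uk_qd i : ~~ odd i -> (0 < i <= m)%N -> Uk_gen (qh_root (diff_root i))
| Uk_qdV i : ~~ odd i -> (0 < i <= m)%N ->
    Uk_gen (qh_root (fun l => - diff_root i l)).

Inductive Uk : Uq -> Prop :=
| Uk_of_gen x : Uk_gen x -> Uk x
| Uk_1 : Uk 1
| Uk_add x y : Uk x -> Uk y -> Uk (x + y)
| Uk_scale c x : Uk x -> Uk (c *: x)
| Uk_mul x y : Uk x -> Uk y -> Uk (x * y).

Definition z_index (i : nat) : bool := odd i && ((i <= m)%N || (bar i <= m)%N).

(* [(-1) ^+ s] is the sign \pm in front of the matrix. *)
Definition A_mx (s : bool) : 'M[K]_N :=
  (-1) ^+ s *:
  (\sum_(1 <= i < m.+1)
      (q ^ (- m%:Z) * (1 - q ^ (- N%:Z + 2 * m%:Z))) *: munit i i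
   + \sum_(m.+1 <= i < bar m) q ^ (- m%:Z) *: munit i i
   + \sum_(1 <= i < N.+1 | z_index i)
      z i *: (munit i (bar i).-1 - munit i.+1 (bar i))).

End Uq.

Section NaturalRep.
Variables (K : fieldType) (q : K) (n : nat).
Hypotheses (q0 : q != 0) (qN1 : forall k, (0 < k)%N -> q ^+ k != 1).

Local Notation N := (2 * n)%N.
Local Notation munit := (@munit K n).
Local Notation nat_e := (nat_e K n).
Local Notation nat_f := (nat_f K n).
Local Notation wt := (nat_wt n).

Let munitM0 a b c d : b != c -> munit a b * munit c d = 0.
Proof.
move=> bc; apply/matrixP=> j k; rewrite !mxE big1 // => l _; rewrite !mxE.
case: (l.+1 =P b) => [->|]; last by rewrite andbF mul0r.
by rewrite (negPf bc) mulr0.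
Qed.

Let munitM a b d : (0 < b <= N)%N -> munit a b * munit b d = munit a d.
Proof.
case: b => // b /= bN; apply/matrixP=> j k; rewrite !mxE.
rewrite (bigD1 (Ordinal bN)) //= !mxE /= eqxx andbT andTb -natrM mulnb.
rewrite big1 ?addr0 // => l lb; rewrite !mxE.
by rewrite eqSS (_ : (val l == b) = false) ?andbF ?mul0r //; apply: negbTE.
Qed.

Let munitM3 a b c d e f :
  (b != c) || (d != e) -> munit a b * munit c d * munit e f = 0.
Proof.
case/orP=> h; first by rewrite munitM0 // mul0r.
by rewrite -mulrA [X in _ * X]munitM0 // mulr0.
Qed.

(* [munit j j] scaled by [q ^ w j], summed over j *)
Definition diag_wt (w : nat -> int) : 'M[K]_N :=
  diag_mx (\row_j q ^ w (val j).+1).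

Let diag_munit w a b : diag_wt w * munit a b = q ^ w a *: munit a b.
Proof.
rewrite -[_ * _]/(_ *m _) mul_diag_mx; apply/matrixP=> j k; rewrite !mxE.
by case: (j.+1 =P a) => [->|_] //=; rewrite !mulr0.
Qed.

Let munit_diag w a b : munit a b * diag_wt w = q ^ w b *: munit a b.
Proof.
rewrite -[_ * _]/(_ *m _) mul_mx_diag; apply/matrixP=> j k; rewrite !mxE mulrC.
by case: (k.+1 =P b) => [->|_] //=; rewrite andbF !mulr0.
Qed.

Let diagM w w' : diag_wt w * diag_wt w' = diag_wt (fun j => w j + w' j).
Proof.
rewrite -[_ * _]/(_ *m _) mulmx_diag; congr diag_mx; apply/rowP=> j.
by rewrite !mxE expfzDr.
Qed.

Let diag0 : diag_wt (fun=> 0) = 1.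
Proof. by apply/matrixP=> j k; rewrite !mxE expr0z. Qed.

Let nat_qhE i : nat_qh q n i = diag_wt (wt i).
Proof.
apply/matrixP=> j k; rewrite summxE !mxE.
under eq_bigr do rewrite !mxE.
rewrite (bigD1_seq j.+1) ?iota_uniq ?mem_index_iota ?ltnS ?ltn_ord //=.
rewrite eqxx big1 ?addr0 => [|l lj].
  by rewrite eqSS eq_sym -val_eqE /=; case: eqP; rewrite ?mulr1 ?mulr0.
by rewrite eq_sym (negPf lj) mulr0.
Qed.

Let wtl i k : (0 < i <= n)%N -> (0 < k <= n)%N -> wt i k = simple_root n i k.
Proof.
rewrite /wt /simple_root /bar => hi hk; case: (i =P n) => ? ;
 [rewrite (_ : (_ == (N.+1 - n)%N) = false) | rewrite
  (_ : (k == N.+1 - i)%N = false) 1?(_ : (k == N.+1 - i.+1)%N = false)]; lia.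
Qed.

Let wtr i k : (0 < i <= n)%N -> (0 < k <= n)%N ->
  wt i (bar n k) = - simple_root n i k.
Proof. by rewrite /wt /simple_root /bar => hi hk; case: (i =P n) => ?; lia. Qed.

Let wtr' i : (0 < i <= n)%N -> wt i n.+1 = - simple_root n i n.
Proof.
by move=> hi; rewrite -wtr //; [congr (wt _ _); rewrite /bar|]; lia.
Qed.

Let sum_delta (F : nat -> int) j : (0 < j <= n)%N ->
  \sum_(1 <= k < n.+1) F k * (k == j)%:Z = F j.
Proof.
move=> hj; rewrite (bigD1_seq j) ?iota_uniq ?mem_index_iota //= eqxx mulr1.
by rewrite big1 ?addr0 // => k /negPf->; rewrite mulr0.
Qed.

Let dotE i j : (0 < i <= n)%N -> (0 < j <= n)%N ->
  root_dot n i j = if j == n then 2 * simple_root n i n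
                   else simple_root n i j - simple_root n i j.+1.
Proof.
move=> hi hj; rewrite /root_dot; have [->|jn] := eqVneq j n.
  under eq_bigr do rewrite {2}/simple_root eqxx PoszM mulrCA.
  by rewrite -mulr_sumr sum_delta //; lia.
under eq_bigr do rewrite {2}/simple_root (negPf jn) mulrBr.
by rewrite sumrB !sum_delta //; lia.
Qed.

Let scAl (c : K) (x y : 'M[K]_N) : c *: (x * y) = (c *: x) * y.
Proof. exact: scalemxAl. Qed.

Let wt_root i j : (0 < i <= n)%N -> (0 < j <= n)%N ->
  diag_wt (wt i) * nat_e j * diag_wt (fun k => - wt i k)
    = q ^ root_dot n i j *: nat_e j.
Proof.
move=> hi hj; rewrite dotE // /nat_e.
have [_|jn] := eqVneq j n.
  rewrite diag_munit -scAl munit_diag scalerA -expfzDr //.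
  by congr (_ ^ _ *: _); rewrite /= wtr' // wtl //; lia.
rewrite mulrBr mulrBl !diag_munit -!scAl !munit_diag !scalerA -!expfzDr //.
by rewrite scalerBr; congr (_ ^ _ *: _ - _ ^ _ *: _);
   [rewrite /= (@wtl i j) ?(@wtl i j.+1)|rewrite /= (@wtr i j.+1) ?(@wtr i j)];
   lia.
Qed.

Let wt_rootf i j : (0 < i <= n)%N -> (0 < j <= n)%N ->
  diag_wt (wt i) * nat_f j * diag_wt (fun k => - wt i k)
    = q ^ (- root_dot n i j) *: nat_f j.
Proof.
move=> hi hj; rewrite dotE // /nat_f.
have [_|jn] := eqVneq j n.
  rewrite diag_munit -scAl munit_diag scalerA -expfzDr //.
  by congr (_ ^ _ *: _); rewrite /= wtr' // wtl //; lia.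
rewrite mulrBr mulrBl !diag_munit -!scAl !munit_diag !scalerA -!expfzDr //.
by rewrite scalerBr; congr (_ ^ _ *: _ - _ ^ _ *: _);
   [rewrite /= (@wtl i j) ?(@wtl i j.+1)|rewrite /= (@wtr i j.+1) ?(@wtr i j)];
   lia.
Qed.

Let ef0 i j : (0 < i <= n)%N -> (0 < j <= n)%N -> i != j ->
  nat_e i * nat_f j = 0 /\ nat_f j * nat_e i = 0.
Proof.
move=> hi hj ij; rewrite /nat_e /nat_f.
by split; case: (i =P n) => ?; case: (j =P n) => ?;
   rewrite ?(mulrBl, mulrBr) !munitM0 ?subrr //; rewrite /bar; lia.
Qed.

Let ee0 i j : (0 < i <= n)%N -> (0 < j <= n)%N ->
  (i == j) || (i.+1 < j)%N || (j.+1 < i)%N ->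
  nat_e i * nat_e j = 0 /\ nat_f i * nat_f j = 0.
Proof.
move=> hi hj ij; rewrite /nat_e /nat_f.
by split; case: (i =P n) => ?; case: (j =P n) => ?;
   rewrite ?(mulrBl, mulrBr) !munitM0 ?subrr //; rewrite /bar; lia.
Qed.

Let eee0 i j : (0 < i <= n)%N -> (0 < j < n)%N -> i != j ->
  nat_e i * nat_e j * nat_e i = 0 /\ nat_f i * nat_f j * nat_f i = 0.
Proof.
move=> hi hj ij; rewrite /nat_e /nat_f.
by rewrite (_ : (j == n) = false); [split; case: (i =P n) => ?;
   rewrite ?(mulrBl, mulrBr) !munitM3 ?subrr // /bar|]; lia.
Qed.

Let qq k : (0 < k)%N -> q ^+ k - q ^- k != 0.
Proof.
move=> k0; rewrite subr_eq0; apply/eqP=> h.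
have/eqP := qN1 (k := (k + k)%N) ltac:(lia); apply.
by rewrite exprD {1}h mulVf // expf_neq0.
Qed.

Let ef1 i : (0 < i <= n)%N ->
  nat_e i * nat_f i - nat_f i * nat_e i =
  (q_ q n i - (q_ q n i)^-1)^-1 *: (diag_wt (wt i) - diag_wt (fun k => - wt i k)).
Proof.
move=> hi.
have -> : nat_e i * nat_f i - nat_f i * nat_e i =
  if i == n then munit n n - munit n.+1 n.+1 else
  munit i i + munit (bar n i.+1) (bar n i.+1)
  - (munit i.+1 i.+1 + munit (bar n i) (bar n i)).
  rewrite /nat_e /nat_f; case: (i =P n) => ein; first by rewrite !munitM //; lia.
  rewrite ?(mulrBl, mulrBr) !munitM ?munitM0 ?subr0 ?sub0r ?opprK //;
    rewrite /bar; lia.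
have q1 : q - q^-1 != 0 by have := qq (isT : (0 < 1)%N); rewrite !expr1.
have q2 : q ^+ 2 - q ^- 2 != 0 by apply: qq.
apply/matrixP=> j k; rewrite /q_; have jN := ltn_ord j.
have [<-|kj] := eqVneq j k; last first.
  have kj0 (a : nat) : (j.+1 == a) && (k.+1 == a) = false.
    by apply: contraNF kj => /andP[/eqP <-]; rewrite eqSS eq_sym.
  by case: ifP => _; rewrite !mxE !kj0 (negPf kj) !mulr0n ?(addr0, subr0, mulr0).
case: (i =P n) => ein; rewrite !mxE eqxx !mulr1n !andbb /nat_wt /bar.
  rewrite ein eqxx (_ : (N.+1 - n)%N = n.+1); last lia.
  have [->|jn] := eqVneq j.+1 n.
    by rewrite (_ : (n == n.+1) = false) ?subr0 ?mulVf //; lia.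
  have [jn1|_] := eqVneq j.+1 n.+1; last by rewrite !muln0 !subrr mulr0.
  by rewrite !sub0r opprK -[X in _ * X]opprB mulrN mulVf.
rewrite (negPf (introN eqP ein)).
have [ji|ji] := eqVneq j.+1 i.
  rewrite (_ : (j.+1 == N.+1 - i)%N = false) 1?(_ : (j.+1 == i.+1) = false) 1?
    (_ : (j.+1 == N.+1 - i.+1)%N = false); try lia.
  by rewrite !(subr0, addr0) mulVf.
have [ji1|ji1] := eqVneq j.+1 i.+1.
  rewrite (_ : (j.+1 == N.+1 - i)%N = false) 1?
    (_ : (j.+1 == N.+1 - i.+1)%N = false); try lia.
  by rewrite !(subr0, addr0, add0r, sub0r) opprK -[X in _ * X]opprB mulrN mulVf.
have [ji2|ji2] := eqVneq j.+1 (N.+1 - i)%N.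
  rewrite (_ : (j.+1 == N.+1 - i.+1)%N = false); last lia.
  by rewrite !(subr0, addr0, add0r, sub0r) opprK -[X in _ * X]opprB mulrN mulVf.
have [ji3|ji3] := eqVneq j.+1 (N.+1 - i.+1)%N.
  by rewrite !(subr0, addr0, add0r, sub0r, oppr0) mulVf.
by rewrite !(subr0, addr0, oppr0) subrr mulr0.
Qed.

Definition nat_gen (x : Uq_gen n) : 'M[K]_N :=
  match x with
  | GenE i => nat_e (val i)
  | GenF i => nat_f (val i)
  | GenK i => diag_wt (wt (val i))
  | GenKV i => diag_wt (fun k => - wt (val i) k)
  end.

Local Notation ev := (eval (@scalar_mx K N) nat_gen).

Let scC (c : K) (x : 'M[K]_N) : c%:M * x = x * c%:M.
Proof. exact/esym/scalar_mxC. Qed.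

Let scE (c : K) (x : 'M[K]_N) : c%:M * x = c *: x.
Proof. exact: mul_scalar_mx. Qed.

Let scAr (c : K) (x y : 'M[K]_N) : x * (c *: y) = c *: (x * y).
Proof. by rewrite -[_ * _]/(_ *m _) -scalemxAr. Qed.

Let serre0 i j x y (s := absz (1 - cartan n i j)) : ev x * ev x = 0 ->
  (s = 1%N /\ ev x * ev y = ev y * ev x) \/
  (s = 2%N /\ ev x * ev y * ev x = 0) \/ s = 3%N ->
  ev (serre q i j x y) = 0.
Proof.
move=> x2 H; rewrite eval_sum -/s.
have {}x2 k : (1 < k)%N -> ev x ^+ k = 0.
  by case: k => // -[|k] // _; rewrite exprS exprS mulrA x2 mul0r.
pose c r : K := (-1) ^+ r * qbinom (q_ q n i) s r.
transitivity (\sum_(r < s.+1)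
  c r *: (ev x ^+ (s - r) * ev y * ev x ^+ r)).
  by apply: eq_bigr => r _; rewrite /= !eval_exp scE.
case: H => [[s1 xy]|[[s2 xyx]|s3]].
- have c1 : c 1%N = - c 0%N.
    by rewrite /c s1 expr1 expr0 mul1r mulN1r /qbinom subnn subn0 [X in _ / X]mulrC.
  rewrite s1 !big_ord_recl big_ord0 /= c1 !expr0 !expr1 mulr1 mul1r addr0 xy.
  by rewrite scaleNr subrr.
- rewrite big1 // s2 => -[[|[|[|r]]] //= hr] _.
  + by rewrite x2 // !mul0r scaler0.
  + by rewrite -[(2 - 1)%N]/1%N !expr1 xyx scaler0.
  + by rewrite (@x2 2) // mulr0 scaler0.
- rewrite big1 // s3 => -[[|[|[|[|r]]]] //= hr] _.
  + by rewrite x2 // !mul0r scaler0.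
  + by rewrite x2 // !mul0r scaler0.
  + by rewrite (@x2 2) // mulr0 scaler0.
  + by rewrite (@x2 3) // mulr0 scaler0.
Qed.

Let cartanP i j : (0 < i <= n)%N -> (0 < j <= n)%N -> i != j ->
  let s := absz (1 - cartan n i j) in
  [\/ s = 1%N /\ (i.+1 < j)%N || (j.+1 < i)%N,
      s = 2%N /\ (j < n)%N | s = 3%N].
Proof.
move=> hi hj ij s; rewrite {}/s /cartan.
have dii : root_dot n i i = if i == n then 4 else 2.
  by rewrite dotE // /simple_root; case: (i =P n) => ?; lia.
have dij : root_dot n i j =
    if (i.+1 < j)%N || (j.+1 < i)%N then 0
    else if (i == n) || (j == n) then - 2%:Z else - 1%:Z.
  rewrite dotE // /simple_root; case: (i =P n) => ?; case: (j =P n) => ?;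
    by case: ifP => ?; rewrite /= ?eqxx; lia.
rewrite dii dij; case: ifP => h; first by apply: Or31; rewrite mulr0 div0z.
case: (i =P n) => [ein|?] /=; first by apply: Or32; split=> //; lia.
by case: (j =P n) => [ejn|?] /=; [apply: Or33|apply: Or32; split=> //; lia].
Qed.

Let serreP (x y : node n) : val x != val y ->
  ev (serre q (val x) (val y) (Gen (GenE x)) (Gen (GenE y))) = 0 /\
  ev (serre q (val x) (val y) (Gen (GenF x)) (Gen (GenF y))) = 0.
Proof.
move=> xy; have [hx hy] := (valP x, valP y).
have xx : (val x == val x) || ((val x).+1 < val x)%N || ((val x).+1 < val x)%N.
  by rewrite eqxx.
have [xxe xxf] := ee0 hx hx xx.
case: (cartanP hx hy xy) => [[s1 h]|[s2 h]|s3].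
- have h' : (val x == val y) || ((val x).+1 < val y)%N || ((val y).+1 < val x)%N.
    by rewrite -orbA h orbT.
  have h'' : (val y == val x) || ((val y).+1 < val x)%N || ((val x).+1 < val y)%N.
    by move: h'; lia.
  have [[exy fxy] [eyx fyx]] := (ee0 hx hy h', ee0 hy hx h'').
  by split; apply: serre0 => //=; left; split; rewrite // ?exy ?fxy ?eyx ?fyx.
- have hy' : (0 < val y < n)%N by move: hy; lia.
  have [e f] := eee0 hx hy' xy.
  by split; apply: serre0 => //=; right; left.
- by split; apply: serre0 => //=; right; right.
Qed.

Let relP s t : Uq_rel q s t -> ev s = ev t.
Proof.
have diag_wtV (w : nat -> int) :
    diag_wt w * diag_wt (fun k => - w k) = 1 /\
    diag_wt (fun k => - w k) * diag_wt w = 1.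
  rewrite !diagM -diag0; split; congr diag_wt; apply/funext=> k.
    by rewrite subrr.
  by rewrite addNr.
case=> {s t} /=; rewrite ?rmorph1 ?rmorph0.
- by move=> i; case: (diag_wtV (wt (val i))).
- by move=> i; case: (diag_wtV (wt (val i))).
- by move=> i j; rewrite !diagM; congr diag_wt; apply/funext=> k; rewrite addrC.
- by move=> i j; rewrite wt_root ?(valP i) ?(valP j) // scE.
- by move=> i j; rewrite wt_rootf ?(valP i) ?(valP j) // scE.
- move=> i; rewrite !scE !scaleN1r ef1 ?(valP i) //.
- move=> i j ij; have [-> ->] := ef0 (valP i) (valP j) ij.
  by rewrite mulr0 addr0.
- by move=> i j ij; case: (serreP ij).
- by move=> i j ij; case: (serreP ij).
Qed.

Lemma natural_rep_exists : exists pi, @is_natural_rep K q n pi.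
Proof.
pose p := lift (@scalar_mx K N) nat_gen : Uq q n -> 'M[K]_N.
have pZ : scalable p by move=> c x; rewrite /p (liftZ scC relP) scE.
have pB : zmod_morphism p.
  by move=> x y; rewrite -(scaleN1r y) /p (liftD scC relP) (liftZ scC relP)
    scE scaleN1r.
have pM : monoid_morphism p.
  by split=> [|x y]; rewrite /p ?(lift1 scC relP) ?(liftM scC relP).
pose HA := GRing.isZmodMorphism.Build (Uq q n) 'M[K]_N p pB.
pose HM := GRing.isMonoidMorphism.Build (Uq q n) 'M[K]_N p pM.
pose HZ := GRing.isScalable.Build K (Uq q n) 'M[K]_N *:%R p pZ.
pose pi : {lrmorphism Uq q n -> 'M[K]_N} := HB.pack p HA HM HZ.
exists pi => i hi; rewrite /e_ /f_ /qh_ /Ugen insubT /= -/p.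
by rewrite nat_qhE /p !(lift_cls scC relP).
Qed.

End NaturalRep.

(* Main.v *)
Require Import Defs.
From mathcomp Require Import all_boot all_order all_algebra.
From mathcomp Require Import reals complex.
From mathcomp Require Import boolp zify ring.

Set Implicit Arguments.
Unset Strict Implicit.
Unset Printing Implicit Defensive.

Import GRing.Theory.
Local Open Scope ring_scope.

(* The matrix A is sparse: apart from the diagonal, row a has a single        *)
(* possibly nonzero entry, in the column of an involution of the outer        *)
(* indices. In the natural representation every generator of U_q(k) is a      *)
(* diagonal matrix or a combination of at most four matrix units; in          *)
(* particular the nested q-brackets F_{\tilde\alpha_i} collapse to one or two *)
(* matrix units, because almost all products of consecutive f_l vanish. The   *)
(* commutation with A then amounts to comparing coefficients of matrix units, *)
(* using z_i z_{i'-1} = q^{-N}.                                               *)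

(** The commutant of A is a subalgebra, so only the generators of U_q(k) have to be checked. On the
    outer indices A splits into 2x2 blocks, one for each pair {a, N-a} with a odd and each pair {a,
    N+2-a} with a even, where a is at most m ([A_swap]). Such a block has diagonal entries d =
    q^{-m} - q^{m-N} and 0 and, as z_i z_{i'-1} = q^{-N}, determinant -q^{-N}; its eigenvalues are
    therefore q^{-m} and -q^{m-N}. On the middle indices A is the scalar q^{-m}.

    A diagonal matrix commutes with A once its weights agree on every pair ([A_comm_diag]); this
    covers the torus elements. For odd i < m the terms of [e_i, A] and [f_i, A] cancel by signs
    ([comm_nat_ef_odd]); for i > m, e_i and f_i act inside the scalar block ([comm_nat_ef_mid]).

    For even i, the matrix units in F_{\tilde\alpha_i} are those of e_i with every outer index
    replaced by its partner, and c_{\alpha_i} is the coefficient that balances the two. What remains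
    differs with the block structure near i: two outer pairs ([comm_X_short]), an outer pair next to
    the scalar block ([comm_X_long]), or no middle block at all ([comm_X_full]). *)

Lemma big_nat_only1 (V : nmodType) (k l j : nat) (P : pred nat) (F : nat -> V) :
  (forall i, (k <= i < l)%N -> P i -> i != j -> F i = 0) ->
  \sum_(k <= i < l | P i) F i = if (k <= j < l)%N && P j then F j else 0.
Proof.
move=> F0; case: ifP => [/andP[hj Pj]|hj].
  rewrite big_mkcond (bigD1_seq j) ?iota_uniq ?mem_index_iota //= Pj.
  rewrite big1_seq ?addr0 // => i; rewrite mem_index_iota => /andP[ij hi].
  by case: ifP => // Pi; apply: F0.
rewrite big1_seq // => i; rewrite mem_index_iota => /andP[Pi hi].
by apply: F0 => //; apply: contraFneq hj => <-; rewrite hi.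
Qed.

(* Matrix units are made atoms, since [mxE] would unfold them. *)
Ltac generalize_munit :=
  repeat match goal with |- context [@munit ?K ?n ?a ?b] =>
    let M := fresh "M" in generalize (@munit K n a b); intro M
  end.
Ltac mx_ring := generalize_munit; apply/matrixP=> ? ?; rewrite !mxE; ring.
Ltac mx_field := generalize_munit; apply/matrixP=> ? ?; rewrite !mxE; field.

(** * Arithmetic of matrix units and diagonal weight matrices *)

Section MatrixUnits.
Variables (K : fieldType) (q : K) (n : nat).
Local Notation N := (2 * n)%N.
Local Notation munit := (@munit K n).
Local Notation diag_wt := (diag_wt q n).

Implicit Types (w : nat -> int) (X Y : 'M[K]_N).

Lemma scaleMl (c : K) X Y : (c *: X) * Y = c *: (X * Y).
Proof. exact/esym/scalemxAl. Qed.

Lemma scaleMr (c : K) X Y : X * (c *: Y) = c *: (X * Y).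
Proof. exact/esym/scalemxAr. Qed.

Lemma comm_scale (c : K) X Y : GRing.comm X Y -> GRing.comm X (c *: Y).
Proof. by rewrite /GRing.comm scaleMl scaleMr => ->. Qed.

Lemma munitM0 a b c d : b != c -> munit a b * munit c d = 0.
Proof.
move=> bc; apply/matrixP=> j k; rewrite !mxE big1 // => l _; rewrite !mxE.
case: (l.+1 =P b) => [->|]; last by rewrite andbF mul0r.
by rewrite (negPf bc) mulr0.
Qed.

Lemma munitM a b d : (0 < b <= N)%N -> munit a b * munit b d = munit a d.
Proof.
case: b => // b bN; apply/matrixP=> j k; rewrite !mxE.
rewrite (bigD1 (Ordinal bN)) //= !mxE /= eqxx andbT /= -natrM mulnb.
rewrite big1 ?addr0 // => l; rewrite -val_eqE /= => lb; rewrite !mxE.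
by rewrite eqSS (negPf lb) andbF mul0r.
Qed.

(** A matrix unit with an index outside 1..N is zero, hence the range test. Having one conditional
    for all products lets [munit_products] decide each of them by linear arithmetic. *)
Lemma munit_mul a b c d : munit a b * munit c d =
  if (b == c) && (0 < b <= N)%N then munit a d else 0.
Proof.
case: eqVneq => [<-|/munitM0-> //] /=; case: ifP => bN; first exact: munitM.
apply/matrixP=> j k; rewrite !mxE big1 // => l _; rewrite !mxE.
by case: (l.+1 =P b) => [lb|_]; rewrite ?andbF ?mul0r //; have := ltn_ord l; lia.
Qed.

Lemma diag_munit w a b : diag_wt w * munit a b = q ^ w a *: munit a b.
Proof.
rewrite -[_ * _]/(_ *m _) mul_diag_mx; apply/matrixP=> j k; rewrite !mxE.
by case: (j.+1 =P a) => [->|_] //=; rewrite !mulr0.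
Qed.

Lemma munit_diag w a b : munit a b * diag_wt w = q ^ w b *: munit a b.
Proof.
rewrite -[_ * _]/(_ *m _) mul_mx_diag; apply/matrixP=> j k; rewrite !mxE mulrC.
by case: (k.+1 =P b) => [->|_] //=; rewrite andbF !mulr0.
Qed.

Lemma comm_diag_munit w a b : w a = w b -> GRing.comm (diag_wt w) (munit a b).
Proof. by move=> wab; rewrite /GRing.comm diag_munit munit_diag wab. Qed.

Lemma diag_wt0 : diag_wt (fun=> 0) = 1.
Proof. by apply/matrixP=> j k; rewrite !mxE expr0z. Qed.

Lemma eq_diag_wt w w' : w =1 w' -> diag_wt w = diag_wt w'.
Proof. by move=> /funext ->. Qed.

Lemma nat_qhE i : nat_qh q n i = diag_wt (nat_wt n i).
Proof.
apply/matrixP=> j k; rewrite summxE !mxE.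
under eq_bigr do rewrite !mxE.
rewrite (@big_nat_only1 _ _ _ j.+1) => [|l _ _ /negPf lj]; last first.
  by rewrite eq_sym lj mulr0.
rewrite !ltnS ltn_ord /= eqxx eqSS [(k : nat) == j]eq_sym val_eqE.
by case: eqP; rewrite ?mulr1 ?mulr0.
Qed.

Hypothesis q0 : q != 0.

Lemma diag_wtM w w' : diag_wt w * diag_wt w' = diag_wt (fun j => w j + w' j).
Proof.
rewrite -[_ * _]/(_ *m _) mulmx_diag; congr diag_mx; apply/rowP=> j.
by rewrite !mxE expfzDr.
Qed.

Lemma diag_wtX w k : diag_wt w ^+ k = diag_wt (fun j => k%:Z * w j).
Proof.
elim: k => [|k IH].
  by rewrite expr0 -diag_wt0; apply: eq_diag_wt => j; rewrite mul0r.
by rewrite exprS IH diag_wtM; apply: eq_diag_wt => j; rewrite intS mulrDl mul1r.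
Qed.

Lemma nat_FqE i : (i < n)%N -> nat_qh q n i * nat_f K n i =
  q^-1 *: (munit i.+1 i - munit (bar n i) (bar n i.+1)).
Proof.
move=> hi; rewrite nat_qhE /nat_f ltn_eqF // mulrBr !diag_munit.
rewrite /nat_wt ltn_eqF // /bar -[q^-1]exprN1 [RHS]scalerBr.
by congr (_ ^ _ *: _ - _ ^ _ *: _); lia.
Qed.

Lemma nat_FqnE : (0 < n)%N ->
  nat_qh q n n * nat_f K n n = q ^- 2 *: munit n.+1 n.
Proof.
move=> n0; rewrite nat_qhE /nat_f eqxx diag_munit /nat_wt eqxx /bar.
by rewrite exprnN; congr (_ ^ _ *: _); lia.
Qed.

End MatrixUnits.

Ltac munit_products :=
  repeat (rewrite ?(mulrBl, mulrBr, mulrDl, mulrDr, scaleMl, scaleMr, mulNr,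
                    mulrN, mul0r, mulr0, scaler0, subr0, sub0r, addr0, add0r);
          rewrite munit_mul;
          match goal with |- context [if ?c then _ else _] =>
            first [ rewrite (_ : c = false); [|lia]
                  | rewrite (_ : c = true); [|lia] ]
          end).

(** * Rows and columns of A, and commutation with the Levi generators *)

Section StabilizedMatrix.
Variables (K : fieldType) (q : K) (n m : nat) (z : nat -> K).
Hypotheses (q0 : q != 0) (m2 : ~~ odd m) (mn : (m <= n)%N).
Local Notation N := (2 * n)%N.
Local Notation munit := (@munit K n).
Local Notation A := (A_mx q n m z false).

(** Equal weights at the row and the column of each off-diagonal unit, (i, i'-1) and (i+1, i'). For
    odd i and even m, the bound [N <= m + i] is equivalent to i' <= m, since equality is excluded by
    parity. *)
Definition swap_invariant (w : nat -> int) :=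
  forall i, (0 < i < N)%N -> odd i -> (i <= m)%N || (N <= m + i)%N ->
    w i = w (N - i)%N /\ w i.+1 = w (N.+1 - i)%N.

Lemma A_comm_diag (w : nat -> int) :
  swap_invariant w -> GRing.comm (diag_wt q n w) A.
Proof.
move=> wP; apply: comm_scale; apply: commrD; first apply: commrD.
- by apply: commr_sum => i _; apply/comm_scale/comm_diag_munit.
- by apply: commr_sum => i _; apply/comm_scale/comm_diag_munit.
rewrite -big_filter big_seq; apply: commr_sum => i.
rewrite mem_filter mem_index_iota /z_index /bar => /andP[/andP[oi hi] iN].
have [||//|w1 w2] := wP i; try lia.
apply: comm_scale; apply: commrB; apply: comm_diag_munit => //.
by rewrite w1; congr w; lia.
Qed.

Let d : K := q ^ (- m%:Z) * (1 - q ^ (- N%:Z + 2 * m%:Z)).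

(* Row [a] of [A] is [A_diag a] in column [a] plus [A_off a] in column
   [A_swap a]. *)
Definition A_diag (a : nat) : K :=
  if (a <= m)%N then d else if (a + m <= N)%N then q ^ (- m%:Z) else 0.

Definition A_off (a : nat) : K :=
  if (m < a)%N && (a + m <= N)%N then 0 else if odd a then z a else - z a.-1.

Definition A_swap (a : nat) : nat := if odd a then (N - a)%N else (N.+2 - a)%N.

Lemma A_munit a b : (0 < a <= N)%N ->
  A * munit a b = A_diag a *: munit a b + A_off (A_swap a) *: munit (A_swap a) b.
Proof.
move=> ha; rewrite /A_mx expr0 scale1r 2!mulrDl !mulr_suml; congr (_ + _).
  rewrite (@big_nat_only1 _ _ _ a) => [|i _ _ ia]; last first.
    by rewrite scaleMl munitM0 ?scaler0.
  rewrite (@big_nat_only1 _ _ _ a) => [|i _ _ ia]; last first.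
    by rewrite scaleMl munitM0 ?scaler0.
  rewrite !andbT !scaleMl munitM // /A_diag /bar.
  do !case: ifP => ?; rewrite ?(addr0, add0r, scale0r) //; lia.
(* Only odd i occur, so the parity of a decides whether column a is i'-1 or i', and thus which i
   contributes. *)
rewrite (@big_nat_only1 _ _ _ (if odd a then N - a else N.+1 - a)%N); last first.
  move=> i hi; rewrite /z_index /bar => /andP[oi hi'] ia.
  by rewrite scaleMl mulrBl !munitM0 ?subrr ?scaler0 //; move: ia; case: ifP; lia.
rewrite /z_index /A_off /A_swap /bar; case: (boolP (odd a)) => oa.
  case: ifP => h1; case: ifP => h2; rewrite ?scale0r //; try lia.
  rewrite (_ : odd _); last lia.
  rewrite scaleMl mulrBl (_ : _.-1 = a); last lia.
  by rewrite munitM // munitM0 ?subr0 //; lia.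
case: ifP => h1; case: ifP => h2; rewrite ?scale0r //; try lia.
rewrite (_ : odd _ = false); last lia.
rewrite scaleMl mulrBl (_ : (N.+1 - (N.+1 - a))%N = a); last lia.
rewrite munitM // munitM0 ?sub0r; last lia.
by rewrite scalerN scaleNr; congr (- (z _ *: munit _ _)); lia.
Qed.

Lemma munit_A a b : (0 < b <= N)%N ->
  munit a b * A = A_diag b *: munit a b + A_off b *: munit a (A_swap b).
Proof.
move=> hb; rewrite /A_mx expr0 scale1r 2!mulrDr !mulr_sumr; congr (_ + _).
  rewrite (@big_nat_only1 _ _ _ b) => [|i _ _ ib]; last first.
    by rewrite scaleMr munitM0 ?scaler0 // eq_sym.
  rewrite (@big_nat_only1 _ _ _ b) => [|i _ _ ib]; last first.
    by rewrite scaleMr munitM0 ?scaler0 // eq_sym.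
  rewrite !andbT !scaleMr munitM // /A_diag /bar.
  do !case: ifP => ?; rewrite ?(addr0, add0r, scale0r) //; lia.
rewrite (@big_nat_only1 _ _ _ (if odd b then b else b.-1)%N); last first.
  move=> i hi; rewrite /z_index /bar => /andP[oi hi'] ib.
  by rewrite scaleMr mulrBr !munitM0 ?subrr ?scaler0 //; move: ib; case: ifP; lia.
rewrite /z_index /A_off /A_swap /bar; case: (boolP (odd b)) => ob.
  case: ifP => h1; case: ifP => h2; rewrite ?scale0r //; try lia.
  rewrite scaleMr mulrBr munitM // munitM0 ?subr0; last lia.
  by congr (_ *: munit _ _); lia.
case: ifP => h1; case: ifP => h2; rewrite ?scale0r //; try lia.
rewrite scaleMr mulrBr (_ : b.-1.+1 = b); last lia.
rewrite munitM // munitM0 ?sub0r; last lia.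
by rewrite scalerN scaleNr; congr (- (_ *: munit _ _)); lia.
Qed.

(** The integer powers are rewritten through q^m and q^n, which [field] can then treat as atoms. *)
Lemma A_diag_lo a : (a <= m)%N ->
  A_diag a = (1 - (q ^+ m) ^+ 2 / (q ^+ n) ^+ 2) / q ^+ m.
Proof.
rewrite /A_diag /d => ->; rewrite mulrC -exprnN expfzDr // -!exprM.
by rewrite ![(_ * 2)%N]mulnC -exprnN [X in 1 - X]mulrC.
Qed.

Lemma A_diag_mid a : (m < a)%N -> (a + m <= N)%N -> A_diag a = (q ^+ m)^-1.
Proof. by rewrite /A_diag ltnNge => /negPf -> ->; rewrite exprnN. Qed.

Lemma A_diag_hi a : (N < a + m)%N -> A_diag a = 0.
Proof. by rewrite /A_diag => ha; rewrite !ifF //; lia. Qed.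

Lemma A_munit_mid a b : (m < a)%N -> (a + m <= N)%N ->
  A * munit a b = (q ^+ m)^-1 *: munit a b.
Proof.
move=> am aN; rewrite A_munit ?A_diag_mid //; last lia.
rewrite /A_off ifT ?scale0r ?addr0 // /A_swap; case: ifP; lia.
Qed.

Lemma munit_A_mid a b : (m < b)%N -> (b + m <= N)%N ->
  munit a b * A = (q ^+ m)^-1 *: munit a b.
Proof.
move=> bm bN; rewrite munit_A ?A_diag_mid //; last lia.
by rewrite /A_off bm bN scale0r addr0.
Qed.

Lemma A_munit_odd a c b : odd a -> (a + c)%N = N -> (a <= m)%N || (c <= m)%N ->
  A * munit a b = A_diag a *: munit a b + z c *: munit c b.
Proof.
move=> oa ac am; rewrite A_munit; last lia.
rewrite /A_swap oa (_ : (N - a)%N = c); last lia.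
by rewrite /A_off ifF ?ifT //; lia.
Qed.

Lemma A_munit_even a c b : ~~ odd a -> (0 < a)%N -> (a + c.+1)%N = N.+2 ->
  (a <= m)%N || (c < m)%N ->
  A * munit a b = A_diag a *: munit a b - z c *: munit c.+1 b.
Proof.
move=> oa a0 ac am; rewrite A_munit; last lia.
rewrite /A_swap (negPf oa) (_ : (N.+2 - a)%N = c.+1); last lia.
by rewrite /A_off ifF ?ifF ?scaleNr //; lia.
Qed.

Lemma munit_A_odd a b c : odd b -> (b + c)%N = N -> (b <= m)%N || (c <= m)%N ->
  munit a b * A = A_diag b *: munit a b + z b *: munit a c.
Proof.
move=> ob bc bm; rewrite munit_A; last lia.
rewrite /A_swap ob (_ : (N - b)%N = c); last lia.
by rewrite /A_off ob ifF //; lia.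
Qed.

Lemma munit_A_even a b c : odd b -> (0 < c)%N -> (b.+1 + c)%N = N.+2 ->
  (b < m)%N || (c <= m)%N ->
  munit a b.+1 * A = A_diag b.+1 *: munit a b.+1 - z b *: munit a c.
Proof.
move=> ob c0 bc bm; rewrite munit_A; last lia.
rewrite /A_swap /= ob (_ : (N.+2 - b.+1)%N = c); last lia.
by rewrite /A_off /= ob /= ifF ?scaleNr //; lia.
Qed.

(** With j = N-i, the pairs are {i, j} and {i+1, j+1}, and e_i is the difference of the units (i,
    i+1) and (j, j+1). Its minus sign cancels the opposite signs with which z_i, and likewise z_j,
    enters A. *)
Lemma comm_nat_ef_odd i : odd i -> (i < m)%N ->
  GRing.comm (nat_e K n i) A /\ GRing.comm (nat_f K n i) A.
Proof.
move=> oi im; rewrite /GRing.comm /nat_e /nat_f ltn_eqF /bar; last lia.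
rewrite (_ : (N.+1 - i.+1 = N - i)%N); last lia.
rewrite (_ : (N.+1 - i = (N - i).+1)%N); last lia.
set j := (N - i)%N.
rewrite !(mulrBr, mulrBl) !(@A_munit_odd i j) ?(@A_munit_odd j i); try lia.
rewrite !(@A_munit_even i.+1 j) ?(@A_munit_even j.+1 i); try lia.
rewrite !(@munit_A_odd _ i j) ?(@munit_A_odd _ j i); try lia.
rewrite !(@munit_A_even _ i j.+1) ?(@munit_A_even _ j i.+1); try lia.
rewrite !(@A_diag_lo i) ?(@A_diag_lo i.+1) ?(@A_diag_hi j) ?(@A_diag_hi j.+1); try lia.
split; mx_ring.
Qed.

Lemma comm_nat_ef_mid i : (m < i <= n)%N ->
  GRing.comm (nat_e K n i) A /\ GRing.comm (nat_f K n i) A.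
Proof.
move=> hi; rewrite /GRing.comm /nat_e /nat_f /bar; case: ifP => _; split.
all: rewrite ?(mulrBr, mulrBl) !A_munit_mid ?munit_A_mid //; lia.
Qed.

End StabilizedMatrix.

(** * Torus elements and F_i in the natural representation *)

Lemma sum_wt_delta n a j : (0 < a <= n)%N ->
  \sum_(1 <= l < n.+1) (l == a)%:Z * nat_wt n l j = nat_wt n a j.
Proof.
move=> ha; rewrite (@big_nat_only1 _ _ _ a) => [|l _ _ /negPf->].
  by rewrite ltnS ha eqxx mul1r.
by rewrite mul0r.
Qed.

(* [2 (alpha_k + ... + alpha_(n-1)) + alpha_n = 2 epsilon_k], by telescoping *)
Lemma sum_wt_long n k j : (0 < k <= n)%N ->
  \sum_(1 <= l < n.+1) (2 * (k <= l < n)%N%:Z + (l == n)%:Z) * nat_wt n l j =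
  2 * ((j == k)%:Z - (j == bar n k)%:Z).
Proof.
move=> hk; pose u l : int := 2 * ((j == l)%:Z - (j == bar n l)%:Z).
(* Here v l is 2 epsilon_l, frozen for l <= k so that no root below k contributes, and 0 beyond n so
   that the last difference is 2 epsilon_n = alpha_n. *)
pose v l := if (l <= k)%N then u k else if (l <= n)%N then u l else 0.
have -> : 2 * ((j == k)%:Z - (j == bar n k)%:Z) = - (v n.+1 - v 1%N).
  by rewrite /v ltnn; do !case: ifP => ?; rewrite /u; lia.
rewrite -telescope_sumr // -sumrN; apply: eq_big_nat => l hl.
rewrite /v /u /nat_wt /bar.
have [->|ln] := eqVneq l n; first by do !case: ifP => ?; rewrite ?mulr1; lia.
have [lk|lk] := leqP k l; last first.
  by rewrite /= mul0r; do !case: ifP => ?; lia.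
have -> : (l < n)%N by lia.
have [->|lk'] := eqVneq l k; do !case: ifP => ?; lia.
Qed.

Section NaturalRepresentation.
Variables (K : fieldType) (q : K) (n : nat).
Variable pi : {lrmorphism Uq q n -> 'M[K]_(2 * n)}.
Hypotheses (q0 : q != 0) (piP : is_natural_rep pi).
Local Notation N := (2 * n)%N.
Local Notation munit := (@munit K n).
Local Notation bar := (bar n).
Local Notation wt := (nat_wt n).
Local Notation diag_wt := (diag_wt q n).

Let piM x y : pi (x * y) = (pi x : 'M[K]_N) * pi y :> 'M[K]_N.
Proof. exact: rmorphM. Qed.

Let piX x k : pi (x ^+ k) = (pi x : 'M[K]_N) ^+ k :> 'M[K]_N.
Proof. exact: rmorphXn. Qed.

Lemma qhV_qh i : (0 < i <= n)%N -> qhV_ q n i * qh_ q n i = 1.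
Proof.
move=> hi; rewrite /qhV_ /qh_ /Ugen insubT -clsM -cls_cst1.
by apply/clsP/cr_rel/rel_QVQ.
Qed.

Lemma pi_qh i : (0 < i <= n)%N -> pi (qh_ q n i) = diag_wt (wt i).
Proof. by move=> /piP[_ _ ->]; rewrite nat_qhE. Qed.

(** [is_natural_rep] prescribes only the image of q^{h_i}; that of q^{-h_i} is forced, being its
    inverse. *)
Lemma pi_qhV i : (0 < i <= n)%N ->
  pi (qhV_ q n i) = diag_wt (fun j => - wt i j).
Proof.
move=> hi; have : pi (qhV_ q n i) * diag_wt (wt i) = 1.
  by rewrite -pi_qh // -piM qhV_qh // rmorph1.
move=> h.
have dV : diag_wt (wt i) * diag_wt (fun j => - wt i j) = 1.
  by rewrite diag_wtM // -(@diag_wt0 K q n); apply: eq_diag_wt => j; rewrite subrr.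
by rewrite -[LHS]mulr1 -dV mulrA h mul1r.
Qed.

Lemma diag_wt_prod (r : seq nat) (w : nat -> nat -> int) :
  \prod_(l <- r) diag_wt (w l) = diag_wt (fun j => \sum_(l <- r) w l j).
Proof.
elim: r => [|l r IH].
  by rewrite big_nil -(@diag_wt0 K q n); apply: eq_diag_wt => j; rewrite big_nil.
by rewrite big_cons IH diag_wtM //; apply: eq_diag_wt => j; rewrite big_cons.
Qed.

Lemma pi_qh_root (b : nat -> int) :
  pi (qh_root q n b) = diag_wt (fun j => \sum_(1 <= l < n.+1) b l * wt l j).
Proof.
rewrite rmorph_prod -diag_wt_prod; apply: eq_big_nat => l hl.
case: (b l) => k; rewrite /= piX ?pi_qh ?pi_qhV // diag_wtX //.
by apply: eq_diag_wt => j; rewrite mulrN NegzE mulNr.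
Qed.

Lemma pi_Fq i : (0 < i < n)%N ->
  pi (Fq q n i) = q^-1 *: (munit i.+1 i - munit (bar i) (bar i.+1)).
Proof.
move=> hi; have /piP[_ hf hq] : (0 < i <= n)%N by lia.
by rewrite piM hf hq nat_FqE //; lia.
Qed.

Lemma pi_Fqn : (0 < n)%N -> pi (Fq q n n) = q ^- 2 *: munit n.+1 n.
Proof.
move=> n0; have /piP[_ hf hq] : (0 < n <= n)%N by rewrite n0 leqnn.
by rewrite piM hf hq nat_FqnE.
Qed.

Lemma pi_qbracket a x y :
  pi (qbracket a x y) =
  (pi x : 'M[K]_N) * pi y - a *: ((pi y : 'M[K]_N) * pi x) :> 'M[K]_N.
Proof. by rewrite -!piM -linearZ -rmorphB. Qed.

End NaturalRepresentation.

(** * Torus parts and nested q-brackets of the X_i *)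

Lemma index_iota_rcons a b : (a <= b)%N ->
  index_iota a b.+1 = rcons (index_iota a b) b.
Proof.
by move=> ab; rewrite /index_iota subSn // -[(b - a).+1]addn1 iotaD cats1 subnKC.
Qed.

Section CoidealGenerators.
Variables (K : fieldType) (q : K) (n m : nat) (z : nat -> K).
Variable pi : {lrmorphism Uq q n -> 'M[K]_(2 * n)}.
Hypotheses (q0 : q != 0) (piP : is_natural_rep pi).
Hypotheses (m2 : ~~ odd m) (mn : (m <= n)%N).
Local Notation N := (2 * n)%N.
Local Notation munit := (@munit K n).
Local Notation bar := (bar n).
Local Notation wt := (nat_wt n).
Local Notation diag_wt := (diag_wt q n).
Local Notation A := (A_mx q n m z false).
Local Notation qb := (qbracket q).


(* \tilde\alpha_i - \alpha_i is alpha_(i-1) + alpha_(i+1) for i < m,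
   alpha_(m-1) + 2 epsilon_(m+1) for i = m < n, and 2 alpha_(n-1) for i = m = n. *)
Definition diff_wt (i j : nat) : int :=
  if (i < m)%N then wt i.-1 j + wt i.+1 j
  else if (m < n)%N then wt m.-1 j + 2 * ((j == m.+1)%:Z - (j == bar m.+1)%:Z)
  else 2 * wt n.-1 j.

Lemma sum_diff_root i j : ~~ odd i -> (0 < i <= m)%N ->
  \sum_(1 <= l < n.+1) diff_root n m i l * wt l j = diff_wt i j.
Proof.
move=> ei hi; rewrite /diff_wt /diff_root /tilde_root.
case: (ltnP i m) => im.
  have h1 : (0 < i.-1 <= n)%N by lia.
  have h2 : (0 < i.+1 <= n)%N by lia.
  rewrite -[wt i.-1 j](sum_wt_delta j h1) -[wt i.+1 j](sum_wt_delta j h2).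
  rewrite -big_split; apply: eq_bigr => l _ /=; rewrite -mulrDl.
  by congr (_ * _); lia.
have -> : i = m by lia.
case: (ltnP m n) => mn'.
  have h1 : (0 < m.-1 <= n)%N by lia.
  rewrite -[wt m.-1 j](sum_wt_delta j h1) -sum_wt_long //.
  rewrite -big_split; apply: eq_bigr => l _ /=; rewrite -mulrDl.
  by congr (_ * _); lia.
rewrite -(@sum_wt_delta n n.-1 j) ?mulr_sumr; last lia.
by apply: eq_bigr => l _; rewrite mulrA; congr (_ * _); lia.
Qed.

Lemma pi_qh_diff i : ~~ odd i -> (0 < i <= m)%N ->
  pi (qh_root q n (diff_root n m i)) = diag_wt (diff_wt i) /\
  pi (qh_root q n (fun l => - diff_root n m i l)) =
    diag_wt (fun j => - diff_wt i j).
Proof.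
move=> ei hi; rewrite !pi_qh_root //; split; apply: eq_diag_wt => j.
  exact: sum_diff_root.
rewrite -sum_diff_root // -sumrN.
by apply: eq_bigr => l _; rewrite mulNr.
Qed.

Lemma pi_Fq_tilde_short i : ~~ odd i -> (0 < i < m)%N ->
  pi (Fq_tilde q n m i) =
  q ^- 2 *: (munit (bar i.-1) (bar i.+2) - munit i.+2 i.-1).
Proof.
move=> ei hi; rewrite /Fq_tilde ifT; last lia.
have -> : i = i.-1.+1 by lia.
have : (0 < i.-1 /\ i.-1.+3 <= n)%N by lia.
move: i.-1 => p hp /=.
rewrite !pi_qbracket !(pi_Fq q0 piP) /Defs.bar; try lia.
munit_products.
by mx_field.
Qed.

(** Each bracket extends the primed unit by right multiplication, with factor -1/q, and the other
    unit by left multiplication, where the index q cancels the q^{-1} of F_l and leaves -1. *)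
Lemma pi_Fq_ascending r : (0 < m)%N -> (m + r < n)%N ->
  pi (foldl qb (Fq q n m) [seq Fq q n l | l <- index_iota m.+1 (m + r).+1]) =
  ((-1) ^+ r.+1 / q ^+ r.+1) *: munit (bar m) (bar (m + r).+1) +
  ((-1) ^+ r / q) *: munit (m + r).+1 m.
Proof.
move=> m0; elim: r => [|r IH] hr.
  rewrite addn0 /index_iota subnn /= (pi_Fq q0 piP); last lia.
  by mx_field.
have -> : index_iota m.+1 (m + r.+1).+1 =
    rcons (index_iota m.+1 (m + r).+1) (m + r).+1.
  by rewrite addnS index_iota_rcons //; lia.
rewrite map_rcons foldl_rcons pi_qbracket IH; last lia.
rewrite (pi_Fq q0 piP) ?addnS; last lia.
move: hr; rewrite addnS /Defs.bar => hr.
munit_products.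
rewrite !(exprS _ r.+1) !(exprS _ r).
by mx_field; rewrite q0 expf_neq0.
Qed.

(** Past F_n the roles of primed and unprimed halves of F_l are exchanged: right multiplication
    contributes 1/q, and left multiplication contributes 1, so b does not change. *)
Lemma pi_Fq_descending r y (a b : K) : (0 < m)%N -> (m + r < n)%N ->
  pi y = a *: munit (bar m) (m + r).+1 + b *: munit (bar (m + r).+1) m ->
  pi (foldl qb y (rev [seq Fq q n l | l <- index_iota m.+1 (m + r).+1])) =
  (a / q ^+ r) *: munit (bar m) m.+1 + b *: munit (bar m.+1) m.
Proof.
move=> m0; elim: r y a => [|r IH] y a hr hy.
  by rewrite /index_iota addn0 subnn /= hy addn0 expr0 divr1.
have -> : index_iota m.+1 (m + r.+1).+1 =
    rcons (index_iota m.+1 (m + r).+1) (m + r).+1.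
  by rewrite addnS index_iota_rcons //; lia.
rewrite map_rcons rev_rcons /=.
rewrite (IH _ (a / q)); first last.
- rewrite pi_qbracket hy (pi_Fq q0 piP) ?addnS; last lia.
  move: hr; rewrite addnS /Defs.bar => hr.
  munit_products.
  by mx_field.
- lia.
by rewrite exprS; mx_field; rewrite q0 expf_neq0.
Qed.

(** Here r = n-m-1 is the length of the run, and r = 0 is the case m = n-1. As m is even, the
    accumulated sign (-1)^{r+1} is (-1)^n. *)
Lemma pi_Fq_tilde_long r : (0 < m)%N -> (m + r.+1)%N = n ->
  pi (Fq_tilde q n m m) =
  (-1) ^+ n *: (q ^- 2 *: munit (bar m.+1) m.-1
                + (q * (q ^+ r.+1) ^+ 2)^-1 *: munit (bar m.-1) m.+1).
Proof.
move=> m0 mr; have mn' : (m < n)%N by lia.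
have en : (-1) ^+ n = (-1) ^+ r.+1 :> K.
  by rewrite -mr exprD -signr_odd (negPf m2) mul1r.
rewrite /Fq_tilde ltnn mn'.
have E : (m + r).+1 = n by lia.
have bn : bar n = n.+1 by rewrite /Defs.bar; lia.
have hup := @pi_Fq_ascending r m0; rewrite E in hup.
have hdown := @pi_Fq_descending r _ _ _ m0; rewrite E in hdown.
have hmid : pi (qbracket (q ^+ 2)
    (foldl qb (Fq q n m) [seq Fq q n l | l <- index_iota m.+1 n]) (Fq q n n)) =
    ((-1) ^+ r.+1 / q ^+ r.+3) *: munit (bar m) n +
    ((-1) ^+ r.+1 / q) *: munit (bar n) m.
  rewrite pi_qbracket hup ?(pi_Fqn q0 piP) ?bn /Defs.bar; try lia.
  munit_products.
  rewrite !exprS.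
  by mx_field; rewrite q0 expf_neq0.
rewrite pi_qbracket (hdown _ _ _ _ hmid) ?(pi_Fq q0 piP) ?prednK; try lia.
rewrite /Defs.bar.
munit_products.
rewrite !exprS en exprS.
by mx_field; rewrite q0 expf_neq0.
Qed.

(** Both orders of multiplication by the two copies of F_{n-1} end in the same unit; their
    contributions add up to the factor q^2+1 that the denominator of c_{\alpha_n} removes. *)
Lemma pi_Fq_tilde_full : (1 < n)%N -> m = n ->
  pi (Fq_tilde q n m m) = ((q ^+ 2 + 1) / q ^+ 4) *: munit n.+2 n.-1.
Proof.
move=> n1 ->; rewrite /Fq_tilde ltnn !pi_qbracket.
rewrite (pi_Fqn q0 piP) ?(pi_Fq q0 piP) ?prednK; try lia.
have -> : bar n.-1 = n.+2 by rewrite /Defs.bar; lia.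
have -> : bar n = n.+1 by rewrite /Defs.bar; lia.
munit_products.
by mx_field.
Qed.

End CoidealGenerators.

(** * Commutation of the X_i with A *)

Lemma nat_wt_lt n i j : (i < n)%N -> nat_wt n i j =
  (j == i)%:Z - (j == bar n i)%:Z - (j == i.+1)%:Z + (j == bar n i.+1)%:Z.
Proof. by move=> hi; rewrite /nat_wt ltn_eqF. Qed.

(** Parity leaves two of the four indicators; the resulting c is symmetric under j -> N-j, which is
    the source of [swap_invariant]. *)
Lemma nat_wt_odd n i j : odd i -> odd j -> (i < n)%N -> (j < 2 * n)%N ->
  let c := (j == i)%:Z + (j == 2 * n - i)%N%:Z in
  nat_wt n i j = c /\ nat_wt n i j.+1 = - c.
Proof.
move=> oi oj hi hj; rewrite !nat_wt_lt // /bar subSS eqSS.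
rewrite (_ : (j == _.+1 - i)%N = false); last lia.
rewrite (_ : (j == i.+1) = false); last lia.
rewrite (_ : (j.+1 == i) = false); last lia.
rewrite (_ : (j.+1 == 2 * n - i)%N = false); last lia.
rewrite (_ : (j.+1 == _.+1 - i)%N = (j == 2 * n - i)%N); last lia.
by split; lia.
Qed.

Section Commutation.
Variables (K : fieldType) (q : K) (n m : nat) (z : nat -> K).
Variable pi : {lrmorphism Uq q n -> 'M[K]_(2 * n)}.
Hypotheses (q0 : q != 0) (qN1 : forall k : nat, (0 < k)%N -> q ^+ k != 1).
Hypotheses (piP : is_natural_rep pi) (m2 : ~~ odd m) (mn : (m <= n)%N).
Local Notation N := (2 * n)%N.
Hypothesis zP : forall i : nat, (0 < i <= N)%N -> z_index n m i ->
  z i * z (bar n i).-1 = q ^ (- N%:Z).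
Local Notation munit := (@munit K n).
Local Notation bar := (bar n).
Local Notation A := (A_mx q n m z false).

Lemma z_swap p s : odd p -> (p < m)%N -> (p + s)%N = N ->
  z p != 0 /\ z s = ((q ^+ n) ^+ 2 * z p)^-1.
Proof.
move=> op pm ps; have zz : z p * z s = (q ^+ n) ^- 2.
  have pN : (0 < p <= N)%N by lia.
  have -> : s = (bar p).-1 by rewrite /Defs.bar; lia.
  by rewrite -exprM mulnC exprnN zP // /z_index op (ltnW pm).
have qn : (q ^+ n) ^- 2 != 0 by rewrite invr_eq0 !expf_neq0.
have zp : z p != 0 by apply: contraNneq qn => zp; rewrite -zz zp mul0r.
by split=> //; rewrite invfM -zz mulrC mulKf.
Qed.

Lemma pi_X i : ~~ odd i -> (0 < i <= m)%N ->
  pi (X_ q n m z i) =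
  diag_wt q n (diff_wt n m i) * nat_e K n i +
  c_coef q n m z i *: (pi (Fq_tilde q n m i) : 'M[K]_N) :> 'M[K]_N.
Proof.
move=> ei hi; have [<- _] := pi_qh_diff q0 piP m2 mn ei hi.
have /piP[<- _ _] : (0 < i <= n)%N by lia.
by rewrite -rmorphM -linearZ -rmorphD.
Qed.

(** All indices are outer. Diagonal terms cancel because each unit joins two indices with the same
    diagonal entry of A. Each unit of e_i and its partner unit in F_{\tilde\alpha_i} then give two
    conditions on c_{\alpha_i}, which agree by [z_swap]. *)
Lemma comm_X_short i : ~~ odd i -> (0 < i < m)%N ->
  GRing.comm (pi (X_ q n m z i) : 'M[K]_N) A.
Proof.
move=> ei hi; rewrite /GRing.comm pi_X ?pi_Fq_tilde_short //; last lia.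
have -> : i = i.-1.+1 by lia.
have : [/\ odd i.-1, (0 < i.-1)%N & (i.-1.+2 < m)%N] by split; lia.
move: i.-1 => p [op p0 pm] /=.
rewrite /nat_e ltn_eqF /c_coef ?ifT /=; try lia.
rewrite mulrBr !diag_munit.
(* With this s the pairs are p and s+2, p+2 and s, p+1 and s+3, p+3 and s+1. *)
pose s := (N - p.+2)%N.
have b3 : bar p.+3 = s by rewrite /Defs.bar; lia.
have b2 : bar p.+2 = s.+1 by rewrite /Defs.bar; lia.
have b1 : bar p.+1 = s.+2 by rewrite /Defs.bar; lia.
have b0 : bar p = s.+3 by rewrite /Defs.bar; lia.
have os : odd s by lia.
have [op2 pn p2n pN] : [/\ odd p.+2, (p < n)%N, (p.+2 < n)%N & (p < N)%N].
  by split; lia.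
have sN : (s < N)%N by lia.
have -> : diff_wt n m p.+1 p.+1 = -1.
  rewrite /diff_wt ifT /=; last lia.
  rewrite (nat_wt_odd op op pn pN).2 (nat_wt_odd op2 op p2n pN).2 eqxx.
  rewrite (_ : (p == N - p)%N = false); last lia.
  rewrite (_ : (p == p.+2) = false); last lia.
  by rewrite (_ : (p == N - p.+2)%N = false) //; lia.
have -> : diff_wt n m p.+1 (bar p.+2) = -1.
  rewrite /diff_wt ifT /= ?b2; last lia.
  rewrite (nat_wt_odd op os pn sN).2 (nat_wt_odd op2 os p2n sN).2 -/s eqxx.
  rewrite (_ : (s == p) = false); last lia.
  rewrite (_ : (s == N - p)%N = false); last lia.
  by rewrite (_ : (s == p.+2) = false) //; lia.
have [zp zs2] := @z_swap p s.+2 op ltac:(lia) ltac:(lia).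
have [zp2 zs] := @z_swap p.+2 s ltac:(lia) ltac:(lia) ltac:(lia).
rewrite b0 b1 b2 b3 exprN1 {b0 b1 b2 b3}.
have Ap1 b := @A_munit_even K q n m z q0 m2 mn p.+1 s.+2 b.
have As1 b := @A_munit_even K q n m z q0 m2 mn s.+1 p.+2 b.
have As3 b := @A_munit_even K q n m z q0 m2 mn s.+3 p b.
have Ap3 b := @A_munit_even K q n m z q0 m2 mn p.+3 s b.
have Bp2 a := @munit_A_odd K q n m z q0 m2 mn a p.+2 s.
have Bs2 a := @munit_A_odd K q n m z q0 m2 mn a s.+2 p.
have Bs a := @munit_A_odd K q n m z q0 m2 mn a s p.+2.
have Bp a := @munit_A_odd K q n m z q0 m2 mn a p s.+2.
(* [A] is made opaque, since the distributivity rewrites would unfold it. *)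
move: (A_mx _ _ _ _ _) Ap1 As1 As3 Ap3 Bp2 Bs2 Bs Bp.
move=> AA Ap1 As1 As3 Ap3 Bp2 Bs2 Bs Bp.
rewrite !(mulrBl, mulrBr, mulrDl, mulrDr, scaleMl, scaleMr).
rewrite !Ap1 ?As1 ?As3 ?Ap3 ?Bp2 ?Bs2 ?Bs ?Bp; try lia.
rewrite {Ap1 As1 As3 Ap3 Bp2 Bs2 Bs Bp}.
rewrite !(@A_diag_lo K q n m q0 p) ?(@A_diag_lo K q n m q0 p.+1)
  ?(@A_diag_lo K q n m q0 p.+2) ?(@A_diag_lo K q n m q0 p.+3)
  ?(@A_diag_hi K q n m q0 m2 mn s) ?(@A_diag_hi K q n m q0 m2 mn s.+1)
  ?(@A_diag_hi K q n m q0 m2 mn s.+2) ?(@A_diag_hi K q n m q0 m2 mn s.+3);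
  try lia.
rewrite zs zs2.
by mx_field; rewrite zp zp2 q0 !expf_neq0.
Qed.

(** With t = N-m, A acts by q^{-m} on the indices m+1 and t. Column m+1 of X_m must be a right
    eigenvector of the block {m, t+2}, and row t a left eigenvector of the block {m-1, t+1}, both
    for the eigenvalue q^{-m}; c_{\alpha_m} achieves this. *)
Lemma comm_X_long : (0 < m < n)%N ->
  GRing.comm (pi (X_ q n m z m) : 'M[K]_N) A.
Proof.
move=> hm; have [r mr] : exists r, (m + r.+1)%N = n by exists (n - m).-1; lia.
have m0 : (0 < m)%N by lia.
rewrite /GRing.comm pi_X ?m0 ?leqnn // (pi_Fq_tilde_long q0 piP m2 mn m0 mr).
rewrite /c_coef ltnn ifT; last lia.
pose t := (N - m)%N; pose p := m.-1.
have mp : m = p.+1 by lia.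
have [op pm] : odd p /\ (p < m)%N by lia.
have bm1 : bar m.+1 = t by rewrite /Defs.bar; lia.
have bm : bar m = t.+1 by rewrite /Defs.bar; lia.
have bp : bar m.-1 = t.+2 by rewrite /Defs.bar; lia.
have ot : ~~ odd t by lia.
rewrite /nat_e ltn_eqF; last lia.
rewrite mulrBr !diag_munit.
have [pn pN] : (p < n)%N /\ (p < N)%N by lia.
have -> : diff_wt n m m m = -1.
  rewrite /diff_wt ltnn ifT ?bm1 -/p; last lia.
  rewrite (_ : (m == m.+1) = false); last lia.
  rewrite (_ : (m == t) = false); last lia.
  rewrite [in nat_wt n p m]mp (nat_wt_odd op op pn pN).2 eqxx.
  by rewrite (_ : (p == N - p)%N = false) //; lia.
have -> : diff_wt n m m (bar m.+1) = -2.
  rewrite /diff_wt ltnn ifT ?bm1 -/p ?eqxx; last lia.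
  rewrite (_ : (t == m.+1) = false); last lia.
  have -> : nat_wt n p t = nat_wt n p t.-1.+1 by congr nat_wt; lia.
  have [ot1 tN] : odd t.-1 /\ (t.-1 < N)%N by lia.
  rewrite (nat_wt_odd op ot1 pn tN).2.
  rewrite (_ : (t.-1 == p) = false); last lia.
  by rewrite (_ : (t.-1 == N - p)%N = false) //; lia.
have [zp zt] := @z_swap p t.+1 op pm ltac:(lia).
rewrite bm1 bm bp -/p exprN1 {bm1 bm bp}.
have Am b := @A_munit_even K q n m z q0 m2 mn m t.+1 b.
have At b := @A_munit_mid K q n m z q0 m2 mn t b.
have At2 b := @A_munit_even K q n m z q0 m2 mn t.+2 p b.
have Bm1 a := @munit_A_mid K q n m z q0 m2 mn a m.+1.
have Bt1 a := @munit_A_odd K q n m z q0 m2 mn a t.+1 p.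
have Bp a := @munit_A_odd K q n m z q0 m2 mn a p t.+1.
move: (A_mx _ _ _ _ _) Am At At2 Bm1 Bt1 Bp => AA Am At At2 Bm1 Bt1 Bp.
rewrite !(mulrBl, mulrBr, mulrDl, mulrDr, scaleMl, scaleMr).
rewrite !Am ?At ?At2 ?Bm1 ?Bt1 ?Bp; try lia.
rewrite {Am At At2 Bm1 Bt1 Bp} -mp.
rewrite !(@A_diag_lo K q n m q0 p) ?(@A_diag_lo K q n m q0 m)
  ?(@A_diag_hi K q n m q0 m2 mn t.+1) ?(@A_diag_hi K q n m q0 m2 mn t.+2);
  try lia.
rewrite zt -[in q ^+ n]mr exprD.
rewrite (exprS _ n) -signr_odd (_ : q ^ (-2) = q ^- 2) //.
by case: (odd n); rewrite ?expr0 ?expr1; mx_field; rewrite zp q0 !expf_neq0.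
Qed.

(** For m = n the diagonal of A vanishes, since d = q^{-n}(1 - 1), so only the cross terms of the
    units (n, n+1) and (n+2, n-1) have to cancel. *)
Lemma comm_X_full : (0 < m)%N -> m = n ->
  GRing.comm (pi (X_ q n m z m) : 'M[K]_N) A.
Proof.
move=> m0 mn'; have n1 : (1 < n)%N by lia.
rewrite /GRing.comm pi_X ?m0 ?leqnn // (pi_Fq_tilde_full q0 piP m2 mn n1 mn').
rewrite /c_coef ltnn mn' ltnn.
pose p := n.-1.
have np : n = p.+1 by lia.
have [op pm] : odd p /\ (p < m)%N by lia.
rewrite /nat_e eqxx diag_munit -/p.
have [pn pN] : (p < n)%N /\ (p < N)%N by lia.
have -> : diff_wt n n n n = -2.
  rewrite /diff_wt ltnn -/p (_ : nat_wt n p n = nat_wt n p p.+1); last first.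
    by rewrite -np.
  have [_ ->] := nat_wt_odd op op pn pN.
  by rewrite eqxx (_ : (p == N - p)%N = false) //; lia.
have [zp zn] := @z_swap p n.+1 op pm ltac:(lia).
have qn : q ^+ n = q * q ^+ p by rewrite {1}np exprS.
(* If q^2 were -1, then q^4 would be 1. *)
have q21 : q ^+ 2 + 1 != 0.
  apply: contraNneq (qN1 (isT : (0 < 4)%N)) => /eqP; rewrite addr_eq0 => /eqP q2.
  by rewrite (exprM q 2 2) q2 sqrrN expr1n.
rewrite scalerA.
have -> : - (1 / ((q ^+ 2 + 1) * q ^+ (N - 2) * z p ^+ 2)) *
    ((q ^+ 2 + 1) / q ^+ 4) = - (q ^+ 4 * (q ^+ p) ^+ 2 * z p ^+ 2)^-1.
  have -> : (N - 2)%N = (p * 2)%N by lia.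
  by rewrite exprM; field; rewrite q21 zp q0 expf_neq0.
have An b := @A_munit_even K q n m z q0 m2 mn n n.+1 b.
have An2 b := @A_munit_even K q n m z q0 m2 mn n.+2 p b.
have Bn1 a := @munit_A_odd K q n m z q0 m2 mn a n.+1 p.
have Bp a := @munit_A_odd K q n m z q0 m2 mn a p n.+1.
rewrite mn' in An An2 Bn1 Bp m0.
move: (A_mx _ _ _ _ _) An An2 Bn1 Bp => AA An An2 Bn1 Bp.
rewrite !(mulrBl, mulrBr, mulrDl, mulrDr, scaleMl, scaleMr).
rewrite !An ?An2 ?Bn1 ?Bp; try lia.
rewrite {An An2 Bn1 Bp} -np.
have m2n : ~~ odd n by rewrite -mn'.
rewrite !(@A_diag_lo K q n n q0 p) ?(@A_diag_lo K q n n q0 n)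
  ?(@A_diag_hi K q n n q0 m2n (leqnn n) n.+1)
  ?(@A_diag_hi K q n n q0 m2n (leqnn n) n.+2); try lia.
rewrite zn (_ : q ^ (-2) = q ^- 2) // qn.
by mx_field; rewrite zp q0 !expf_neq0.
Qed.

End Commutation.

(** * Invariance of the torus weights, and passage from the generators to U_q(k) *)

Lemma nat_wt_mid n m i j : (m < i <= n)%N -> (j <= m)%N || (2 * n < j + m)%N ->
  nat_wt n i j = 0.
Proof.
move=> hi hj; have e1 : (j == i) = false by lia.
have [ein|ni] := eqVneq i n.
  rewrite /nat_wt -ein eqxx e1.
  by rewrite (_ : (j == _) = false) // /bar; lia.
rewrite nat_wt_lt /bar ?subSS ?e1; last lia.
rewrite (_ : (j == i.+1) = false); last lia.
rewrite (_ : (j == _.+1 - i)%N = false); last lia.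
by rewrite (_ : (j == 2 * n - i)%N = false); last lia.
Qed.

Lemma eps_mid n m j : (m < n)%N -> (j <= m)%N || (2 * n < j + m)%N ->
  (j == m.+1)%:Z - (j == bar n m.+1)%:Z = 0.
Proof.
move=> hm hj; rewrite (_ : (j == m.+1) = false); last lia.
by rewrite (_ : (j == _) = false) // /bar; lia.
Qed.

Section Stabilizer.
Variables (K : fieldType) (q : K) (n m : nat) (z : nat -> K).
Variable pi : {lrmorphism Uq q n -> 'M[K]_(2 * n)}.
Hypotheses (q0 : q != 0) (qN1 : forall k : nat, (0 < k)%N -> q ^+ k != 1).
Hypotheses (piP : is_natural_rep pi) (m2 : ~~ odd m) (mn : (m <= n)%N).
Local Notation N := (2 * n)%N.
Hypothesis zP : forall i : nat, (0 < i <= N)%N -> z_index n m i ->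
  z i * z (bar n i).-1 = q ^ (- N%:Z).
Local Notation A := (A_mx q n m z false).
Local Notation wt := (nat_wt n).
Local Notation swap_invariant := (swap_invariant n m).

Lemma swap_invariantN w : swap_invariant w -> swap_invariant (fun j => - w j).
Proof. by move=> wP i hi oi im; have [-> ->] := wP i hi oi im. Qed.

Lemma swap_invariant_wt_odd i : odd i -> (i < n)%N -> swap_invariant (wt i).
Proof.
move=> oi hi j hj oj jm; rewrite (_ : (N.+1 - j = (N - j).+1)%N); last lia.
have [-> ->] := nat_wt_odd oi oj hi ltac:(lia).
have [-> ->] := @nat_wt_odd n i (N - j) oi ltac:(lia) hi ltac:(lia).
rewrite (_ : (N - j == i)%N = (j == N - i)%N); last lia.
by rewrite (_ : (N - j == N - i)%N = (j == i)) 1?addrC; last lia.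
Qed.

Lemma swap_invariant_wt i : in_Pi_l n m i -> swap_invariant (wt i).
Proof.
case/orP=> [/andP[oi im]|hi].
  by apply: swap_invariant_wt_odd => //; apply: leq_trans im mn.
by move=> j hj oj jm; rewrite !(@nat_wt_mid n m i); try lia.
Qed.

Lemma swap_invariant_diff i : ~~ odd i -> (0 < i <= m)%N ->
  swap_invariant (diff_wt n m i).
Proof.
move=> ei hi j hj oj jm; rewrite /diff_wt.
have [w1 w2] := @swap_invariant_wt_odd i.-1 ltac:(lia) ltac:(lia) j hj oj jm.
case: ifP => im.
  have [w3 w4] := @swap_invariant_wt_odd i.+1 ltac:(lia) ltac:(lia) j hj oj jm.
  by rewrite w1 w2 w3 w4.
have im' : i = m by lia.
case: ifP => mn'; last by rewrite (_ : n.-1 = i.-1) ?w1 ?w2 //; lia.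
by rewrite -im' w1 w2 im' !eps_mid //; lia.
Qed.

Lemma comm_Uk_gen x : Uk_gen m z x -> GRing.comm (pi x : 'M[K]_N) A.
Proof.
have nodeP i : in_Pi_l n m i -> (0 < i <= n)%N by rewrite /in_Pi_l; lia.
have ef i : in_Pi_l n m i ->
    GRing.comm (nat_e K n i) A /\ GRing.comm (nat_f K n i) A.
  by case/orP=> [/andP[oi im]|im];
     [apply: comm_nat_ef_odd|apply: comm_nat_ef_mid].
case=> {x} i hi.
- by have [-> _ _] := piP (nodeP i hi); have [] := ef i hi.
- by have [_ -> _] := piP (nodeP i hi); have [] := ef i hi.
- rewrite (pi_qh piP (nodeP i hi)); apply: A_comm_diag => //.
  exact: swap_invariant_wt.
- rewrite (pi_qhV q0 piP (nodeP i hi)); apply: A_comm_diag => //.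
  exact/swap_invariantN/swap_invariant_wt.
- move=> him; have [im|im] := ltnP i m; first by apply: comm_X_short => //; lia.
  have -> : i = m by lia.
  have [mn'|nm] := ltnP m n; first by apply: comm_X_long => //; lia.
  by apply: comm_X_full => //; lia.
- move=> him; have [-> _] := pi_qh_diff q0 piP m2 mn hi him.
  by apply: A_comm_diag => //; apply: swap_invariant_diff.
- move=> him; have [_ ->] := pi_qh_diff q0 piP m2 mn hi him.
  by apply: A_comm_diag => //; apply/swap_invariantN/swap_invariant_diff.
Qed.

Lemma comm_Uk x : Uk m z x -> GRing.comm (pi x : 'M[K]_N) A.
Proof.
elim=> {x} [x /comm_Uk_gen //||x y _ IHx _ IHy|c x _ IHx|x y _ IHx _ IHy].
- by rewrite rmorph1; apply/commr_sym/commr1.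
- by rewrite rmorphD; apply/commr_sym/commrD; apply/commr_sym.
- by rewrite linearZ; apply/commr_sym/comm_scale/commr_sym.
- by rewrite rmorphM; apply/commr_sym/commrM; apply/commr_sym.
Qed.

End Stabilizer.

Theorem mainTheorem6 (R : realType) (q : R[i]) (n m : nat) (s : bool)
    (z : nat -> R[i]) (pi : {lrmorphism Uq q n -> 'M[R[i]]_(2 * n)}) :
  q != 0 ->
  (forall k : nat, (0 < k)%N -> q ^+ k != 1) ->
  (0 < n)%N ->
  ~~ odd m ->
  (m <= n)%N ->
  (forall i : nat, (0 < i <= 2 * n)%N -> z_index n m i ->
     z i * z (bar n i).-1 = q ^ (- (2 * n)%N%:Z)) ->
  is_natural_rep pi ->
  forall x : Uq q n, Uk m z x ->
    pi x *m A_mx q n m z s = A_mx q n m z s *m pi x.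
Proof.
move=> q0 qN1 _ m2 mn zP piP x xk.
have -> : A_mx q n m z s = (-1) ^+ s *: A_mx q n m z false.
  by rewrite /A_mx expr0 scale1r.
exact/comm_scale/comm_Uk.
Qed.
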